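(* Consider the system $$\dot x_1=f_1(t,x_1)+a(t,x_1)\mathsf B(t,x_1)x_2,\qquad\dot x_2=f_2(t,x_1,x_2),\qquad(x_1,x_2)\in\mathbb R^{n_1}\times\mathbb R^{n_2},$$ with output $y=x_1$, where $f_1:\mathbb R_{\ge0}\times\mathbb R^{n_1}\to\mathbb R^{n_1}$ and $f_2:\mathbb R_{\ge0}\times\mathbb R^{n_1}\times\mathbb R^{n_2}\to\mathbb R^{n_2}$ are $C^0$ and locally Lipschitz in $x_1$ and $(x_1,x_2)$, respectively, $a\in C^1(\mathbb R_{\ge0}\times\mathbb R^{n_1};\mathbb R)$ and $\mathsf B\in C^1(\mathbb R_{\ge0}\times\mathbb R^{n_1};\mathbb R^{n_1\times n_2})$. Let $M\subset\mathbb R^{n_1}\times\mathbb R^{n_2}$ be nonempty with $0\in\mathrm{cl}\,M$ and assume the system is $M$-forward complete, with bound $\beta\in NNN$. Assume: (1) There exist an integer $\ell\in\mathbb N$ and a map $\mathsf D\in C^0(\mathbb R_{\ge0}\times\mathbb R^\ell\times\mathbb R^{n_1};\mathbb R^{n_2\times n_2})$ such that for every $R>0$, $t_0\ge0$ and $\xi>0$ there exists a set-valued map $[t_0,\infty)\ni t\mapsto Q_R(t)=Q_{R,t_0,\xi}(t)\subset\mathbb R^\ell$ satisfying the CP such that for every $t\ge t_0$, every $y\in Y_R(t):=\{y\in\mathbb R^{n_1}:y=x_1\text{ for some }x=(x_1,x_2)\text{ with }|x|\le\beta(t,t_0,R)\}$ and all $x_2,z_2\in\mathbb R^{n_2}$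 with $|x_2|\le\beta(t,t_0,R)$, $|x_2-z_2|\le\xi$, there is $q\in Q_R(t)$ with $f_2(t,y,x_2)-f_2(t,y,z_2)=\mathsf D(t,q,y)(x_2-z_2)$. (2) There exists a constant $L>1$ such that for every $R>0$ there exists $\varepsilon_R>0$ such that for every $\bar t_0\ge t_0\ge0$, $\tau_0>0$, $\xi>0$ and $y\in Y(\mathbb R_{\ge0},M)\cap C^0([t_0,\infty);\mathbb R^{n_1})$ there exist a time-varying symmetric matrix $P_R=P_{R,t_0,\bar t_0,\tau_0,\xi,y}\in C^1([\bar t_0,\infty);\mathbb R^{n_2\times n_2})$ and a function $d_R=d_{R,t_0,\bar t_0,\tau_0,\xi,y}\in C^0([\bar t_0,\infty);\mathbb R)$, both $\tau_0$-noncausal with respect to $Y(\mathbb R_{\ge0},M)$, with $$P_R(t)\ge I\ \ \forall t\ge\bar t_0,\qquad|P_R(\bar t_0)|\le L,$$ $$\int_{\bar t_0}^td_R(s)\,ds>-\varepsilon_R\ \ \forall t\ge\bar t_0,\qquad\int_{\bar t_0}^\infty d_R(s)\,ds=\infty,$$ and, provided that $y\in Y(\mathbb R_{\ge0},B_R\cap M)\cap C^0([t_0,\infty);\mathbb R^{n_1})$, $$e'P_R(t)\mathsf D(t,q,y(t))e+\tfrac12e'\dot P_R(t)e\le-d_R(t)e'P_R(t)e\quad\forall t\ge\bar t_0,\ e\in\ker\mathsf B(t,y(t)),\ q\in Q_R(t),$$ where $Q_R=Q_{R,t_0,\xi}$ and $\mathsf D$ are those of (1). (3) For every $t_0\ge0$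 and $x_0\in M$ it holds $a(t,x_1(t,t_0,x_0))\ne0$ for a.e. $t\ge t_0$. Then the AC-SODP is solvable for the system with respect to $Y(\mathbb R_{\ge0},M)$.
   Context: Notation: $|x|$ is the Euclidean norm, $|A|=\max\{|Ax|:|x|=1\}$ the induced matrix norm, $A'$ the transpose, $B_R$ the closed ball of radius $R$ centered at $0$ in the state space $\mathbb R^n$, $n=n_1+n_2$, $\mathrm{cl}$ the closure; matrix inequalities are in the sense of quadratic forms. $N$ is the class of increasing continuous functions $\mathbb R_{\ge0}\to\mathbb R_{\ge0}$; $NNN$ is the class of continuous functions $\beta:(\mathbb R_{\ge0})^3\to\mathbb R_{\ge0}$ that belong to $N$ with respect to each of their three arguments. CP (Compactness Property): a set-valued map $[t_0,\infty)\ni t\mapsto Q(t)\subset\mathbb R^\ell$ satisfies the CP if for every sequence $t_\nu\to t$ in $[t_0,\infty)$ and $q_\nu\in Q(t_\nu)$ there are a subsequence $(q_{\nu_k})$ and $q\in Q(t)$ with $q_{\nu_k}\to q$. Forward completeness and outputs: $x(\cdot,t_0,x_0)=(x_1(\cdot,t_0,x_0),x_2(\cdot,t_0,x_0))$ is the solution with $x(t_0)=x_0$. The system is $M$-forward complete if there is $\beta\in NNN$ with $|x(t,t_0,x_0)|\le\beta(t,t_0,|x_0|)$ for all $t\ge t_0\ge0$, $x_0\in M$; this $\beta$ is fixed. For $I\subset\mathbb R_{\ge0}$, $Y(I,M)$ is the set of all outputs $y:[t_0,\infty)\to\mathbb R^k$ (here $k=n_1$), $y(t)=x_1(t,t_0,x_0)$,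 with $(t_0,x_0)\in I\times M$. Causality: let $\Omega$ be a set of functions $y:[t_0,\infty)\to\mathbb R^k$ parameterized by initial data $(t_0,x_0)$, and $0\le\tau\le\infty$. An object $a_{t_0,y}$ (a function of time $t$ in a subinterval of $[t_0,\infty)$ and possibly of further variables, possibly depending on further fixed parameters) assigned to each $y\in\Omega\cap C^0([t_0,\infty);\mathbb R^k)$ is $\tau$-noncausal with respect to $\Omega$ if its value at time $t$ depends only on the values $y(s)$, $t_0\le s\le t+\tau$, of $y$. When, for every $y$, existence of a $\tau$-noncausal object is asserted, the objects are understood as such a family indexed by $y$. AC-SODP (Almost Causal Switching Observer Design Problem): it is solvable for the system with respect to $Y(\mathbb R_{\ge0},M)$ if for every $t_0\ge0$, $\tau>0$ and $y\in Y(\mathbb R_{\ge0},M)\cap C^0([t_0,\infty);\mathbb R^k)$ there exist: a strictly increasing sequence of times $(t_m)_{m\in\mathbb N}$ with $t_1=t_0$ and $\lim_{m\to\infty}t_m=\infty$; a sequence of continuous mappings $g_m=g_{m,t_m,y}(t,z,w):[t_{m-1},t_{m+1}]\times\mathbb R^n\times\mathbb R^k\to\mathbb R^n$, $m\in\mathbb N$, which are $\tau$-noncausal with respect to $Y(\mathbb R_{\ge0},M)$; and a nonempty set $\bar M\subset\mathbb R^n$, such that any solution $z_m(\cdot)$ of $\dot z_m=g_m(t,z_m,y(t))$ with $z_m(t_{m-1})\in\bar M$ is defined for each $t\in[t_{m-1},t_{m+1}]$, $m\in\mathbb N$, and, with $Z(t):=z_m(t)$ for $t\in[t_m,t_{m+1})$,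 $m\in\mathbb N$, one has $\lim_{t\to\infty}(x(t)-Z(t))=0$, where $x(\cdot)=x(\cdot,t_0,x_0)$, $x_0\in M$, is the trajectory of the system with output $y$. *)

(* Defs.v *)
From HB Require Import structures.
From mathcomp Require Import all_boot all_order all_algebra.
From mathcomp Require Import all_classical all_reals all_analysis.

Set Implicit Arguments.
Unset Strict Implicit.
Unset Printing Implicit Defensive.
Import Order.TTheory GRing.Theory Num.Theory.
Import numFieldNormedType.Exports.
Local Open Scope classical_set_scope.
Local Open Scope ring_scope.

Section Linear.
Context {R : realType}.

(* The library norm [`|x|] on matrices is the max norm; it defines the same
   topology. *)
Definition enorm {n} (x : 'cV[R]_n) : R := Num.sqrt (\sum_i x i ord0 ^+ 2).

Definition opnorm {m n} (A : 'M[R]_(m, n)) : R :=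
  sup [set enorm (A *m u) | u in [set u : 'cV[R]_n | enorm u = 1]].

Definition qform {n} (A : 'M[R]_n) (e : 'cV[R]_n) : R :=
  (e^T *m A *m e) ord0 ord0.

Definition loewner_le {n} (A B : 'M[R]_n) : Prop :=
  forall e, qform A e <= qform B e.

Definition eball {n} (r : R) : set 'cV[R]_n := [set x | enorm x <= r].

End Linear.

Section Regularity.
Context {R : realType}.

(* Functions of time are total; only their values on the relevant interval
   are constrained.  [is_derivative_on J f t l] is the derivative at [t]
   relative to [J], hence one-sided at an endpoint of [J]. *)
Definition is_derivative_on {V : normedModType R} (J : set R) (f : R -> V)
    (t : R) (l : V) : Prop :=
  (fun s => (s - t)^-1 *: (f s - f t)) @ within J t^' --> l.

Definition C1_on {V : normedModType R} (J : set R) (f df : R -> V) : Prop :=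
  (forall t, J t -> is_derivative_on J f t (df t)) /\
  {within J, continuous df}.

Definition halfspace {V : Type} : set (R * V) := [set p | 0 <= p.1].

Definition C0_halfspace {V W : normedModType R} (f : R -> V -> W) : Prop :=
  {within halfspace, continuous (fun p : R * V => f p.1 p.2)}.

(* Continuous partial derivatives, the one in [t] being one-sided at [0]. *)
Definition C1_halfspace {V W : normedModType R} (f : R -> V -> W) : Prop :=
  exists (ft : R -> V -> W) (fx : V -> R -> V -> W),
    [/\ forall t x, 0 <= t ->
          is_derivative_on `[0, +oo[ (fun s => f s x) t (ft t x),
        forall v t x, 0 <= t -> is_derive x v (f t) (fx v t x),
        C0_halfspace ft
      & forall v, C0_halfspace (fx v)].

Definition locally_lipschitz_x {m n} (f : R -> 'cV[R]_m -> 'cV[R]_n) : Prop :=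
  forall t x, 0 <= t -> exists r K : R, 0 < r /\
    forall s u v, 0 <= s -> `|s - t| <= r ->
      enorm (u - x) <= r -> enorm (v - x) <= r ->
      enorm (f s u - f s v) <= K * enorm (u - v).

(* "Increasing" is not necessarily strict. *)
Definition NNN (beta : R -> R -> R -> R) : Prop :=
  [/\ {within [set p : R * R * R | [/\ 0 <= p.1.1, 0 <= p.1.2 & 0 <= p.2]],
        continuous (fun p => beta p.1.1 p.1.2 p.2)},
      forall t s r, 0 <= t -> 0 <= s -> 0 <= r -> 0 <= beta t s r
    & forall t s r t' s' r', 0 <= t -> 0 <= s -> 0 <= r ->
        (t <= t' -> beta t s r <= beta t' s r) /\
        (s <= s' -> beta t s r <= beta t s' r) /\
        (r <= r' -> beta t s r <= beta t s r')].

Definition compactness_property {l} (t0 : R) (Q : R -> set 'cV[R]_l) : Prop :=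
  forall (u : nat -> R) (q : nat -> 'cV[R]_l) (t : R), t0 <= t ->
    (forall i, t0 <= u i) -> u @ \oo --> t -> (forall i, Q (u i) (q i)) ->
    exists (phi : nat -> nat) (q' : 'cV[R]_l),
      [/\ {homo phi : i j / (i < j)%N}, Q t q' & q \o phi @ \oo --> q'].

End Regularity.

Section Systems.
Context {R : realType} {n k : nat}.

Definition ode_solution (J : set R) (G : R -> 'cV[R]_n -> 'cV[R]_n)
    (x : R -> 'cV[R]_n) : Prop :=
  forall t, J t -> is_derivative_on J x t (G t (x t)).

Variables (F : R -> 'cV[R]_n -> 'cV[R]_n) (h : R -> 'cV[R]_n -> 'cV[R]_k).

Definition trajectory (t0 : R) (x0 : 'cV[R]_n) (x : R -> 'cV[R]_n) : Prop :=
  x t0 = x0 /\ ode_solution `[t0, +oo[ F x.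

Definition forward_complete (M : set 'cV[R]_n) (beta : R -> R -> R -> R) :=
  NNN beta /\
  forall t0 x0, 0 <= t0 -> M x0 -> exists x, trajectory t0 x0 x /\
    forall t, t0 <= t -> enorm (x t) <= beta t t0 (enorm x0).

(* An output [y : [t0, oo) -> R^k] is the pair [(t0, y)]. *)
Definition outputs (I : set R) (M : set 'cV[R]_n) : set (R * (R -> 'cV[R]_k)) :=
  [set p | I p.1 /\ exists x0 x, [/\ M x0, trajectory p.1 x0 x
     & forall t, p.1 <= t -> p.2 t = h t (x t)]].

Definition C0_outputs (Omega : set (R * (R -> 'cV[R]_k))) (t0 : R) :
    set (R -> 'cV[R]_k) :=
  [set y | Omega (t0, y) /\ {within `[t0, +oo[, continuous y}].

(* [obj] is a family indexed by [y]; its member [obj y] is a function of time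
   on [dom y].  Values at a common time of two members must agree as soon as
   the two outputs agree up to [tau] ahead of that time. *)
Definition noncausal {T : Type} (tau : R) (Omega : set (R * (R -> 'cV[R]_k)))
    (t0 : R) (dom : (R -> 'cV[R]_k) -> set R)
    (obj : (R -> 'cV[R]_k) -> R -> T) : Prop :=
  forall y1 y2 t, C0_outputs Omega t0 y1 -> C0_outputs Omega t0 y2 ->
    dom y1 t -> dom y2 t ->
    (forall s, t0 <= s -> s <= t + tau -> y1 s = y2 s) ->
    obj y1 t = obj y2 t.

(* "Any solution starting in [Mbar] is defined on [[a, b]]": every solution
   on a subinterval containing [a] extends to [[a, b]].  Taking [J = [set a]],
   this includes existence. *)
Definition complete_from (a b : R) (G : R -> 'cV[R]_n -> 'cV[R]_n)
    (Mbar : set 'cV[R]_n) : Prop :=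
  forall (J : set R) z, is_interval J -> J a -> J `<=` `[a, b] ->
    Mbar (z a) -> ode_solution J G z ->
    exists2 z', ode_solution `[a, b] G z' & forall t, J t -> z' t = z t.

(* Switching times are [ts y 1 < ts y 2 < ...]; [ts y 0] is the initial time,
   so that [ts y 0 = ts y 1 = t0]. *)
Definition AC_SODP_solvable (M : set 'cV[R]_n) : Prop :=
  let Omega := outputs [set t | 0 <= t] M in
  forall t0 tau : R, 0 <= t0 -> 0 < tau ->
  exists (ts : (R -> 'cV[R]_k) -> nat -> R)
         (g : nat -> (R -> 'cV[R]_k) -> R -> 'cV[R]_n -> 'cV[R]_k -> 'cV[R]_n)
         (Mbar : (R -> 'cV[R]_k) -> set 'cV[R]_n),
    (forall m, (0 < m)%N ->
       noncausal tau Omega t0 (fun y => `[ts y m.-1, ts y m.+1]%classic) (g m)) /\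
    forall y, C0_outputs Omega t0 y ->
      let G m t z := g m y t z (y t) in
      [/\ ts y 0%N = t0 /\ ts y 1%N = t0,
          forall m, (0 < m)%N -> ts y m < ts y m.+1,
          ts y @ \oo --> +oo,
          forall m, (0 < m)%N ->
            {within [set p : R * 'cV[R]_n * 'cV[R]_k |
                       p.1.1 \in `[ts y m.-1, ts y m.+1]],
              continuous (fun p => g m y p.1.1 p.1.2 p.2)}
        & [/\ Mbar y !=set0,
          forall m, (0 < m)%N ->
            complete_from (ts y m.-1) (ts y m.+1) (G m) (Mbar y)
        & forall x0 x, M x0 -> trajectory t0 x0 x ->
            (forall t, t0 <= t -> y t = h t (x t)) ->
          forall (z : nat -> R -> 'cV[R]_n) (Z : R -> 'cV[R]_n),
            (forall m, (0 < m)%N -> Mbar y (z m (ts y m.-1)) /\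
               ode_solution `[ts y m.-1, ts y m.+1] (G m) (z m)) ->
            (forall m t, (0 < m)%N -> t \in `[ts y m, ts y m.+1[ ->
               Z t = z m t) ->
            (fun t => x t - Z t) @ +oo --> (0 : 'cV[R]_n)]].

End Systems.

Section Triangular.
Context {R : realType} {n1 n2 : nat}.

Definition triangular_field (f1 : R -> 'cV[R]_n1 -> 'cV[R]_n1)
    (f2 : R -> 'cV[R]_n1 -> 'cV[R]_n2 -> 'cV[R]_n2)
    (a : R -> 'cV[R]_n1 -> R) (B : R -> 'cV[R]_n1 -> 'M[R]_(n1, n2))
    (t : R) (x : 'cV[R]_(n1 + n2)) : 'cV[R]_(n1 + n2) :=
  let x1 := usubmx x in let x2 := dsubmx x in
  col_mx (f1 t x1 + a t x1 *: (B t x1 *m x2)) (f2 t x1 x2).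

Definition triangular_output (t : R) (x : 'cV[R]_(n1 + n2)) : 'cV[R]_n1 :=
  usubmx x.

End Triangular.

(* Main.v *)
(** Let [x] and [w] be trajectories with the same output on [[t0, T]].  Since
    [a] vanishes only on a null set along [x], the difference [e] of their [x2]
    components stays in the kernel of [B], so that (1) and (2) give
    [V' <= - 2 d V] for [V = e' P e].  Hence [|e|^2 <= L |e(t0)|^2 exp (- 2 int d)],
    a bound that does not depend on [T]; as [int d > - eps_R], with [eps_R]
    independent of [xi], it also keeps [|e| <= xi] for a [xi] fixed in advance.

    So no feedback is needed in the observer.  With steps of length [tau / 2],
    stage [m] takes any trajectory [w_m], issued from a nearly smallest point of
    [M], whose output is [y] on [[t0, t_(m-1) + tau]], which contains
    [[t0, t_(m+1)]].  This choice is [tau]-noncausal, and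
    [w_m (t) - exp (- K_m (t - t_(m-1))) w_m (t_(m-1))] starts at [0] and, for
    large [K_m], is within [1 / m] of [w_m] from the time [t_m] on. *)
Require Import Defs.
From HB Require Import structures.
From mathcomp Require Import all_boot all_order all_algebra.
From mathcomp Require Import all_classical all_reals all_analysis.
From mathcomp Require Import ring lra.

Set Implicit Arguments.
Unset Strict Implicit.
Unset Printing Implicit Defensive.
Import Order.TTheory GRing.Theory Num.Theory.
Import numFieldNormedType.Exports.
Local Open Scope classical_set_scope.
Local Open Scope ring_scope.

(** * Derivatives relative to a set of times *)

Section RelativeDerivative.
Context {R : realType}.

Lemma is_derivative_onP {V : normedModType R} (J : set R) (f : R -> V) t l :
  is_derivative_on J f t l <->
  forall e, 0 < e -> exists2 r, 0 < r & forall s, J s -> s != t ->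
    `|s - t| < r -> `|l - (s - t)^-1 *: (f s - f t)| < e.
Proof.
rewrite /is_derivative_on cvgrPdist_lt; split=> H e e0.
  have /nbhs_normP [r /= r0 Hr] := H e e0.
  exists r => // s Js st lt; apply: Hr => //=.
  by rewrite distrC.
have [r r0 Hr] := H e e0.
apply/nbhs_normP; exists r => //= s /= lt st Js; apply: Hr => //.
by rewrite distrC.
Qed.

Lemma is_derivative_on_subset {V : normedModType R} (J K : set R) (f : R -> V) t l :
  K `<=` J -> is_derivative_on J f t l -> is_derivative_on K f t l.
Proof.
move=> KJ /is_derivative_onP H; apply/is_derivative_onP => e /H[r r0 Hr].
by exists r => // s /KJ; apply: Hr.
Qed.

Lemma is_derivative_on_eq {V : normedModType R} (J : set R) (f g : R -> V) t l :
  J t -> (forall s, J s -> f s = g s) ->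
  is_derivative_on J f t l -> is_derivative_on J g t l.
Proof.
move=> Jt fg /is_derivative_onP H; apply/is_derivative_onP => e /H[r r0 Hr].
by exists r => // s Js *; rewrite -!fg //; apply: Hr.
Qed.

Lemma is_derivative_onD {V : normedModType R} (J : set R) (f g : R -> V) t k l :
  is_derivative_on J f t k -> is_derivative_on J g t l ->
  is_derivative_on J (fun s => f s + g s) t (k + l).
Proof.
move=> Hf Hg; rewrite /is_derivative_on.
under eq_fun do rewrite opprD addrACA scalerDr.
exact: cvgD.
Qed.

Lemma is_derivative_onN {V : normedModType R} (J : set R) (f : R -> V) t k :
  is_derivative_on J f t k -> is_derivative_on J (fun s => - f s) t (- k).
Proof.
move=> Hf; rewrite /is_derivative_on.
under eq_fun do rewrite -opprD scalerN.
exact: cvgN.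
Qed.

Lemma is_derivative_onB {V : normedModType R} (J : set R) (f g : R -> V) t k l :
  is_derivative_on J f t k -> is_derivative_on J g t l ->
  is_derivative_on J (fun s => f s - g s) t (k - l).
Proof. by move=> Hf Hg; apply/is_derivative_onD/is_derivative_onN. Qed.

Lemma is_derivative_on_entry {m n} (J : set R) (f : R -> 'M[R]_(m, n)) t l i j :
  is_derivative_on J f t l -> is_derivative_on J (fun s => f s i j) t (l i j).
Proof.
move=> H; rewrite /is_derivative_on.
have -> : (fun s => (s - t)^-1 *: (f s i j - f t i j)) =
    (fun A : 'M[R]_(m, n) => A i j) \o (fun s => (s - t)^-1 *: (f s - f t)).
  by apply/funext => s /=; rewrite !mxE.
exact: (cvg_comp _ _ H (@coord_continuous _ m n i j l)).
Qed.

Lemma is_derivative_on_cvg {V : normedModType R} (J : set R) (f : R -> V) t l :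
  is_derivative_on J f t l -> f @ within J (nbhs t) --> f t.
Proof.
move=> /is_derivative_onP /(_ 1 ltr01)[r r0 Hr]; apply/cvgrPdist_lt => e e0.
have l1 : 0 < `|l| + 1 by rewrite ltr_wpDl.
apply/nbhs_normP; exists (Num.min r (e / (`|l| + 1))) => /=.
  by rewrite lt_min r0 divr_gt0.
move=> s /=; rewrite distrC lt_min => /andP[sr se] Js.
have [->|st] := eqVneq s t; first by rewrite subrr normr0.
have st0 : s - t != 0 by rewrite subr_eq0.
have := Hr s Js st sr; rewrite distrC => /ltW H.
have : `|(s - t)^-1 *: (f s - f t)| <= `|l| + 1.
  by rewrite -[X in `|X|](subrK l) (le_trans (ler_normD _ _))// addrC lerD2l.
rewrite normrZ normfV ler_pdivrMl ?normr_gt0// distrC => /le_lt_trans -> //.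
by rewrite -ltr_pdivlMr.
Qed.

Lemma is_derivative_on_continuous {V : normedModType R} (J : set R) (f df : R -> V) :
  (forall t, J t -> is_derivative_on J f t (df t)) -> {within J, continuous f}.
Proof.
by move=> H; apply/subspace_continuousP => t /H; exact: is_derivative_on_cvg.
Qed.

(** Bridge to the library derivative, in terms of which monotonicity and mean value results are
    stated; it is available only where [J] is a neighbourhood of [t]. *)
Lemma is_derivative_on_is_derive {V : normedModType R} (J : set R) (f : R -> V)
    (t : R) (l : V) :
  nbhs t J -> is_derivative_on J f t l -> is_derive t 1 f l.
Proof.
move=> /nbhs_normP[r0 /= r00 Jr0] /is_derivative_onP H.
have L : (h^-1 *: ((f \o shift t) (h *: (1 : R)) - f t) @[h --> 0^']) --> l.
  apply/cvgrPdist_lt => e /H[r r_gt0 Hr].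
  apply/nbhs_normP; exists (Num.min r r0) => /=; first by rewrite lt_min r_gt0.
  move=> h /=; rewrite sub0r normrN lt_min => /andP[hr hr0] h0.
  have := Hr (h + t); rewrite addrK; rewrite /= /GRing.scale/= mulr1.
  apply => //.
    by apply: Jr0 => /=; rewrite opprD addrCA subrr addr0 normrN.
  by rewrite -subr_eq0 addrK.
by split; [apply/cvg_ex; exists l | exact: cvg_lim].
Qed.

Lemma is_derive_is_derivative_on {V : normedModType R} (J : set R) (f : R -> V)
    (t : R) (l : V) :
  is_derive t 1 f l -> is_derivative_on J f t l.
Proof.
move=> [fd <-]; apply/is_derivative_onP => e e0.
have /cvgrPdist_lt /(_ _ e0) /nbhs_normP[r /= r0 Hr] := fd.
exists r => // s Js st sr.
have := Hr (s - t); rewrite /= sub0r normrN subr_eq0 /GRing.scale/= mulr1 subrK.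
by apply.
Qed.

Lemma nbhs_oo (a b t : R) : a < t < b -> nbhs t `[a, b]%classic.
Proof.
move=> /andP[at_ tb]; have: t \in `]a, b[ by rewrite in_itv/= at_ tb.
by move=> /near_in_itvoo H; near=> s; apply: subset_itv_oo_cc; near: s.
Unshelve. all: by end_near.
Qed.

Lemma derive_le0_le (f df : R -> R) (a b : R) : a <= b ->
  {within `[a, b], continuous f} ->
  (forall t, a < t < b -> is_derive t 1 f (df t) /\ df t <= 0) -> f b <= f a.
Proof.
move=> ab cf H; have := @ler0_derive1_le_cc _ f a b _ _ cf.
apply => //; rewrite ?in_itv/= ?lexx ?ab//.
  by move=> x; rewrite in_itv/= => /H[[]].
by move=> x; rewrite in_itv/= => /H[[? dfx] df0]; rewrite derive1E dfx.
Qed.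

(** The entries of [c * (f - g)] have zero derivative, hence do not increase; [c = 1] and [c = -1]
    together give equality. The observer fields built below are functions of time alone, and this
    lemma identifies their solutions. *)
Lemma is_derivative_on_unique {m n} (J : set R) (f g df : R -> 'M[R]_(m, n)) a :
  is_interval J -> J a -> (forall t, J t -> a <= t) -> f a = g a ->
  (forall t, J t -> is_derivative_on J f t (df t)) ->
  (forall t, J t -> is_derivative_on J g t (df t)) ->
  forall t, J t -> f t = g t.
Proof.
move=> Ji Ja Ja_min fga Hf Hg t Jt.
have at_ := Ja_min t Jt.
have sub : `[a, t] `<=` J.
  by move=> s /=; rewrite in_itv/= => /andP[? ?]; apply: (Ji a t) => //; apply/andP.
have le0 (c : R) i j : c * (f t i j - g t i j) <= 0.
  have D s : `[a, t]%classic s ->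
      is_derivative_on `[a, t] (fun s => c * (f s i j - g s i j)) s 0.
    move=> /sub Js.
    have := is_derivative_onB (Hf s Js) (Hg s Js).
    move=> /(is_derivative_on_subset sub) /(is_derivative_on_entry (i := i) (j := j)).
    rewrite subrr mxE => /(@cvgMr _ _ _ _ _ c 0).
    rewrite mulr0 /is_derivative_on; apply: cvg_trans; apply: near_eq_cvg.
    by apply: nearW => u /=; rewrite !mxE /GRing.scale /=; ring.
  rewrite [leRHS](_ : _ = c * (f a i j - g a i j)); last first.
    by rewrite fga subrr mulr0.
  apply: (@derive_le0_le (fun s => c * (f s i j - g s i j)) (fun=> 0)) => //.
    exact: is_derivative_on_continuous D.
  move=> s /[dup] /nbhs_oo st /andP[as_ sb]; split => //.
  by apply: is_derivative_on_is_derive st (D s _); rewrite /= in_itv/= !ltW.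
apply/matrixP => i j; apply/eqP; rewrite -subr_eq0 eq_le.
have := le0 1 i j; rewrite mul1r => ->/=.
by have := le0 (-1) i j; rewrite mulN1r oppr_le0.
Qed.

End RelativeDerivative.

(** * Comparison of the max norm and the Euclidean norm *)

Section MatrixNorm.
Context {R : realType}.

Lemma ler_entry {m n} (A : 'M[R]_(m, n)) i j : `|A i j| <= `|A|.
Proof.
by rewrite [leRHS]/Num.Def.normr/= mx_normrE; exact: (le_bigmax _ _ (i, j)).
Qed.

Lemma mx_norm_le {m n} (A : 'M[R]_(m, n)) c :
  0 <= c -> (forall i j, `|A i j| <= c) -> `|A| <= c.
Proof.
move=> c0 H; rewrite [leLHS]/Num.Def.normr/= mx_normrE.
by apply/bigmax_leP; split=> // -[i j] _; exact: H.
Qed.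

Lemma cvg_mx {T : Type} {F : set_system T} {FF : Filter F} {m n}
    (f : T -> 'M[R]_(m, n)) (l : 'M[R]_(m, n)) :
  (forall i j, (fun x => f x i j) @ F --> l i j) -> f @ F --> l.
Proof.
move=> H; apply/cvgrPdist_le => e e0.
have : \forall x \near F, forall ij : 'I_m * 'I_n, `|l ij.1 ij.2 - f x ij.1 ij.2| <= e.
  by apply: filter_forall => -[i j]; move: (H i j) => /cvgrPdist_le; exact.
apply: filterS => x Hx; apply: mx_norm_le (ltW e0) _ => i j.
by rewrite !mxE; exact: (Hx (i, j)).
Qed.

Lemma enormE {n} (x : 'cV[R]_n) : enorm x ^+ 2 = \sum_i x i ord0 ^+ 2.
Proof. by rewrite sqr_sqrtr// sumr_ge0// => i _; rewrite sqr_ge0. Qed.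

Lemma enorm_ge0 {n} (x : 'cV[R]_n) : 0 <= enorm x.
Proof. exact: sqrtr_ge0. Qed.

Lemma norm_le_enorm {n} (x : 'cV[R]_n) : `|x| <= enorm x.
Proof.
apply: mx_norm_le (enorm_ge0 x) _ => i j.
rewrite (ord1 j) -(@ler_sqr R) ?nnegrE ?enorm_ge0// enormE -normrX ger0_norm ?sqr_ge0//.
by rewrite (bigD1 i)//= lerDl sumr_ge0// => k _; rewrite sqr_ge0.
Qed.

(** The constant is not sharp; [n.+1] is positive in every dimension, so radii can be divided by
    it. *)
Lemma enorm_le_norm {n} (x : 'cV[R]_n) : enorm x <= n.+1%:R * `|x|.
Proof.
rewrite -(@ler_sqr R) ?nnegrE ?enorm_ge0 ?mulr_ge0// enormE exprMn.
apply: (@le_trans _ _ (\sum_(i < n) `|x| ^+ 2)).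
  apply: ler_sum => i _; rewrite -real_normK ?num_real//.
  by rewrite lerXn2r ?nnegrE ?ler_entry.
rewrite sumr_const card_ord -[leLHS]mulr_natl ler_wpM2r ?sqr_ge0//.
by rewrite -natrX ler_nat (leq_trans (leqnSn n))// -mulnn leq_pmulr.
Qed.

Lemma enorm0 {n} : enorm (0 : 'cV[R]_n) = 0.
Proof. by rewrite /enorm big1 ?sqrtr0// => i _; rewrite mxE expr0n. Qed.

End MatrixNorm.

(** * Continuity and Lipschitz bounds on the half-space of nonnegative times *)

Section Halfspace.
Context {R : realType}.

Lemma C0_halfspaceP {V W : normedModType R} (f : R -> V -> W) :
  C0_halfspace f <-> forall (t : R) (x : V), 0 <= t ->
    (fun p => f p.1 p.2) @ within halfspace (nbhs (t, x)) --> f t x.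
Proof.
rewrite /C0_halfspace subspace_continuousP.
split=> [H t x t0|H [t x] /= t0]; [exact: (H (t, x))|exact: H].
Qed.

(** Asking for all small radii, rather than for one, lets several local properties be combined by
    filter reasoning. *)
Lemma within_halfspace_nbhs {V : normedModType R} (P : R * V -> Prop)
    (t : R) (x : V) :
  within halfspace (nbhs (t, x)) P <->
  \forall r \near 0^'+, forall s u,
    0 <= s -> `|s - t| <= r -> `|u - x| <= r -> P (s, u).
Proof.
split.
  move=> /nbhs_ballP[e /= e0 He]; near=> r => s u s0 st ux.
  apply: (He (s, u)) => //.
  have re : r < e by near: r; exact: nbhs_right_lt.
  by split; rewrite /= -ball_normE/= distrC (le_lt_trans _ re).
move=> H; near (0 : R)^'+ => r.
have r0 : 0 < r by near: r; exact: nbhs_right_gt.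
have Hr : forall s u, 0 <= s -> `|s - t| <= r -> `|u - x| <= r -> P (s, u).
  by near: r.
apply/nbhs_ballP; exists r => // -[s u] [/= bs bu] s0.
by move: bs bu; rewrite -!ball_normE/= => bs bu; apply: Hr; rewrite // distrC ltW.
Unshelve. all: by end_near. Qed.

Definition locally_bounded {V W : normedModType R} (f : R -> V -> W) :=
  forall t x, 0 <= t -> exists2 K, 0 <= K & \forall r \near 0^'+, forall s u,
    0 <= s -> `|s - t| <= r -> `|u - x| <= r -> `|f s u| <= K.

(** Counterpart of [locally_lipschitz_x] for the library norm, with a nonnegative constant and valid
    for all small radii. *)
Definition locally_lipschitz {V W : normedModType R} (f : R -> V -> W) :=
  forall t x, 0 <= t -> exists2 K, 0 <= K & \forall r \near 0^'+, forall s u v,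
    0 <= s -> `|s - t| <= r -> `|u - x| <= r -> `|v - x| <= r ->
    `|f s u - f s v| <= K * `|u - v|.

Lemma C0_halfspace_locally_bounded {V W : normedModType R} (f : R -> V -> W) :
  C0_halfspace f -> locally_bounded f.
Proof.
move=> /C0_halfspaceP H t x t0; exists (`|f t x| + 1); first exact: addr_ge0.
have /cvgrPdist_le/(_ 1 ltr01) := H t x t0.
move=> /within_halfspace_nbhs; apply: filterS => r Hr s u s0 st ux.
have := Hr s u s0 st ux; rewrite /= distrC => le1.
by rewrite -[X in `|X|](subrK (f t x)) (le_trans (ler_normD _ _))// addrC lerD2l.
Qed.

(** The increment from [(t, x)] to [(s, u)] is split at [(s, x)]: the Lipschitz bound, uniform in
    time, controls one part and continuity in time the other. *)
Lemma locally_lipschitz_C0 {V W : normedModType R} (f : R -> V -> W) :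
  locally_lipschitz f ->
  (forall (t : R) (x : V), 0 <= t -> f^~ x @ within `[0, +oo[ (nbhs t) --> f t x) ->
  C0_halfspace f.
Proof.
move=> Lf Tf; apply/C0_halfspaceP => t x t0; apply/cvgrPdist_le => e e0.
have [K K0 LK] := Lf t x t0.
have /cvgrPdist_le/(_ (e / 2) (divr_gt0 e0 (ltr0Sn _ 1))) := Tf t x t0.
move=> /nbhs_normP[d /= d0 Hd].
apply/within_halfspace_nbhs.
have e2K : 0 < e / 2 / (K + 1) by rewrite !divr_gt0// ltr_wpDl.
near=> r => s u s0 st ux /=.
have r0 : 0 < r by near: r; exact: nbhs_right_gt.
have rd : r < d by near: r; exact: nbhs_right_lt.
have re : r < e / 2 / (K + 1) by near: r; exact: nbhs_right_lt.
rewrite (le_trans (ler_distD (f s x) _ _))//.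
rewrite [leRHS]splitr lerD//.
  by apply: Hd => //=; rewrite ?in_itv/= ?andbT// distrC (le_lt_trans _ rd).
have : `|f s u - f s x| <= K * `|u - x|.
  have : forall s u v, 0 <= s -> `|s - t| <= r -> `|u - x| <= r -> `|v - x| <= r ->
    `|f s u - f s v| <= K * `|u - v| by near: r.
  by apply; rewrite // subrr normr0 ltW.
rewrite distrC => /le_trans -> //.
apply: (@le_trans _ _ ((K + 1) * r)).
  by apply: ler_pM => //; rewrite lerDl.
by rewrite mulrC -ler_pdivlMr ?ltr_wpDl// ltW.
Unshelve. all: by end_near. Qed.

Lemma mean_value_le (f df : R -> R) (a b K : R) :
  (forall t : R, is_derive t 1 f (df t)) ->
  (forall t, Num.min a b <= t <= Num.max a b -> `|df t| <= K) ->
  `|f b - f a| <= K * `|b - a|.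
Proof.
move=> Hf; wlog ab : a b / a <= b.
  move=> H HK; have [ab|/ltW ba] := leP a b; first exact: H.
  by rewrite distrC [in leRHS]distrC; apply: H => // t; rewrite minC maxC; exact: HK.
move=> HK.
have cf : {within `[a, b], continuous f}.
  by apply: derivable_within_continuous => x _; have [] := Hf x.
have [c cab ->] := MVT_segment ab (fun x _ => Hf x) cf.
rewrite normrM ler_wpM2r//; apply: HK.
by move: cab; rewrite in_itv/= (min_idPl ab) (max_idPr ab).
Qed.

Lemma is_derive_line {V W : normedModType R} (f : V -> W) (p e : V) (h : R) (l : W) :
  is_derive (p + h *: e) e f l -> is_derive h 1 (fun h : R => f (p + h *: e)) l.
Proof.
move=> [fd fl].
have E : (fun k : R => k^-1 *: (((fun h : R => f (p + h *: e)) \o shift h) (k *: (1 : R))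
       - f (p + h *: e))) =
     (fun k => k^-1 *: ((f \o shift (p + h *: e)) (k *: e) - f (p + h *: e))).
  apply/funext => k /=; congr (_ *: (f _ - _)).
  by rewrite [k *: _]mulr1 scalerDl addrCA.
by split; rewrite /derivable /derive E.
Qed.

(** Continuous partial derivatives are locally bounded, and the mean value theorem is applied along
    one coordinate direction after the other. *)
Lemma C1_halfspace_locally_lipschitz {n} (f : R -> 'cV[R]_n -> R) :
  C1_halfspace f -> locally_lipschitz f.
Proof.
move=> [ft [fx [_ Hx _ Cx]]] t x t0.
pose E i : 'cV[R]_n := delta_mx i ord0.
have /choice[k Hk] : forall i, exists K, 0 <= K /\ \forall r \near 0^'+, forall s u,
    0 <= s -> `|s - t| <= r -> `|u - x| <= r -> `|fx (E i) s u| <= K.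
  move=> i; have [K K0 HK] := C0_halfspace_locally_bounded (Cx (E i)) x t0.
  by exists K.
pose K := \sum_i k i.
have K0 : 0 <= K by apply: sumr_ge0 => i _; have [] := Hk i.
have kK i : k i <= K.
  by rewrite /K (bigD1 i)//= lerDl sumr_ge0// => j _; have [] := Hk j.
exists (n%:R * K); first exact: mulr_ge0.
have : \forall r \near 0^'+, forall i, forall s u,
    0 <= s -> `|s - t| <= r -> `|u - x| <= r -> `|fx (E i) s u| <= k i.
  by apply: filter_forall => i; have [] := Hk i.
apply: filterS => r Hr s u v s0 st ux vx.
(* [p] leads from [u] to [v], changing one coordinate at a time. *)
pose p m : 'cV[R]_n := \col_i (if (i < m)%N then v i ord0 else u i ord0).
have p0 : p 0%N = u by apply/colP => i; rewrite mxE.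
have pn : p n = v by apply/colP => i; rewrite mxE ltn_ord.
suff H m : (m <= n)%N -> `|f s u - f s (p m)| <= m%:R * (K * `|u - v|).
  by rewrite -{1}pn -mulrA; exact: H.
elim: m => [_|m IH mn]; first by rewrite p0 subrr normr0 mul0r.
rewrite (le_trans (ler_distD (f s (p m)) _ _))//.
rewrite -natr1 mulrDl mul1r lerD ?IH ?(ltnW mn)//.
set i := Ordinal mn.
pose c := v i ord0 - u i ord0.
have pS : p m.+1 = p m + c *: E i.
  apply/colP => j; rewrite !mxE eqxx andbT ltnS leq_eqVlt.
  have [/eqP jm|jm] := eqVneq (j : nat) m.
    have -> : j = i by apply/val_inj/eqP.
    by rewrite ltnn eqxx mulr1 /c addrC subrK.
  rewrite (_ : (j == i) = false) ?mulr0 ?addr0//.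
  by apply/negbTE; apply: contra jm => /eqP ->.
have := @mean_value_le (fun h => f s (p m + h *: E i))
  (fun h => fx (E i) s (p m + h *: E i)) 0 c K.
rewrite scale0r addr0 -pS subr0 => H.
rewrite distrC (le_trans (H _ _))//.
- by move=> h; apply: is_derive_line; exact: Hx.
(* A ball of the max norm is a box: a point whose coordinates lie between those of [u] and [v] stays
   in it. *)
- move=> h hc; apply: le_trans (kK i); apply: Hr => //.
  apply: mx_norm_le => [|j j0]; first exact: le_trans ux.
  rewrite (ord1 j0) {j0} !mxE eqxx andbT.
  have uj := le_trans (ler_entry (u - x) j ord0) ux.
  have vj := le_trans (ler_entry (v - x) j ord0) vx.
  rewrite !mxE in uj vj.
  have [ji|ji] := eqVneq j i; last first.
    by rewrite mulr0 addr0; case: ifP.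
  rewrite ji ltnn mulr1 -ji; move: hc uj vj; rewrite /c -ji !ler_norml.
  have [uv|uv] := lerP 0 (v j ord0 - u j ord0); lra.
rewrite ler_wpM2l// distrC.
by have := ler_entry (u - v) i ord0; rewrite !mxE.
Qed.

End Halfspace.

(** * Regularity of the triangular vector field *)

Section RegularFields.
Context {R : realType}.

(** The two properties are bundled to be stable under products: the Lipschitz bound of a product
    needs local boundedness, which comes from continuity. *)
Definition regular_scalar {V : normedModType R} (f : R -> V -> R) :=
  locally_lipschitz f /\ C0_halfspace f.

Lemma regular_scalarD {V : normedModType R} (f g : R -> V -> R) :
  regular_scalar f -> regular_scalar g ->
  regular_scalar (fun t x => f t x + g t x).
Proof.
move=> [Lf /C0_halfspaceP Cf] [Lg /C0_halfspaceP Cg]; split; last first.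
  by apply/C0_halfspaceP => t x t0; apply: cvgD; [exact: Cf|exact: Cg].
move=> t x t0; have [K K0 HK] := Lf t x t0; have [L L0 HL] := Lg t x t0.
exists (K + L); first exact: addr_ge0.
move: HK HL; apply: filterS2 => r HK HL s u v *.
rewrite opprD addrACA mulrDl (le_trans (ler_normD _ _))//.
by rewrite lerD//; [exact: HK|exact: HL].
Qed.

Lemma regular_scalarM {V : normedModType R} (f g : R -> V -> R) :
  regular_scalar f -> regular_scalar g ->
  regular_scalar (fun t x => f t x * g t x).
Proof.
move=> [Lf Cf] [Lg Cg]; split; last first.
  move: Cf Cg => /C0_halfspaceP Cf /C0_halfspaceP Cg.
  by apply/C0_halfspaceP => t x t0; apply: cvgM; [exact: Cf|exact: Cg].
have Bf := C0_halfspace_locally_bounded Cf.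
have Bg := C0_halfspace_locally_bounded Cg.
move=> t x t0; have [K K0 HK] := Lf t x t0; have [L L0 HL] := Lg t x t0.
have [k k0 Hk] := Bf t x t0; have [l l0 Hl] := Bg t x t0.
exists (k * L + K * l); first by rewrite addr_ge0 ?mulr_ge0.
near=> r => s u v s0 st ux vx.
have -> : f s u * g s u - f s v * g s v =
    f s u * (g s u - g s v) + (f s u - f s v) * g s v by ring.
rewrite (le_trans (ler_normD _ _))// !normrM mulrDl -mulrA lerD//.
  apply: ler_pM => //.
    have : forall s u, 0 <= s -> `|s - t| <= r -> `|u - x| <= r -> `|f s u| <= k
      by near: r.
    exact.
  have : forall s u v, 0 <= s -> `|s - t| <= r -> `|u - x| <= r -> `|v - x| <= r ->
    `|g s u - g s v| <= L * `|u - v| by near: r.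
  exact.
rewrite mulrAC; apply: ler_pM => //.
  have : forall s u v, 0 <= s -> `|s - t| <= r -> `|u - x| <= r -> `|v - x| <= r ->
    `|f s u - f s v| <= K * `|u - v| by near: r.
  exact.
have : forall s u, 0 <= s -> `|s - t| <= r -> `|u - x| <= r -> `|g s u| <= l
  by near: r.
exact.
Unshelve. all: by end_near. Qed.

Lemma regular_scalar_sum {V : normedModType R} n (f : 'I_n -> R -> V -> R) :
  (forall i, regular_scalar (f i)) ->
  regular_scalar (fun t x => \sum_i f i t x).
Proof.
move=> Hf; have -> : (fun t x => \sum_i f i t x) =
    \big[(fun g h t x => g t x + h t x)/(fun _ _ => 0)]_i f i.
  apply/funext => t; apply/funext => x.
  by elim/big_ind2 : _ => // a b c d -> ->.
elim/big_ind : _ => [|f1 f2|i _]; [|exact: regular_scalarD|exact: Hf].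
split; last by apply/C0_halfspaceP => t x _; exact: cvg_cst.
move=> t x t0; exists 0 => //; apply: nearW => r s u v *.
by rewrite subrr normr0 mul0r.
Qed.

(** Meant for [usubmx], which is nonexpansive for the max norm. *)
Lemma regular_scalar_comp {m n p q} (L : 'M[R]_(p, q) -> 'M[R]_(m, n))
    (f : R -> 'M[R]_(m, n) -> R) :
  (forall u v, `|L u - L v| <= `|u - v|) ->
  regular_scalar f -> regular_scalar (fun t x => f t (L x)).
Proof.
move=> L1 [Lf Cf]; split.
  move=> t x t0; have [K K0 HK] := Lf t (L x) t0; exists K => //.
  apply: filterS HK => r HK s u v s0 st ux vx.
  apply: (le_trans (HK s (L u) (L v) s0 st _ _)).
  - exact: le_trans (L1 _ _) _.
  - exact: le_trans (L1 _ _) _.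
  by rewrite ler_wpM2l.
move: Cf => /C0_halfspaceP Cf; apply/C0_halfspaceP => t x t0.
have {}Cf := Cf t (L x) t0.
apply: (@cvg_comp _ _ _ (fun p => (p.1, L p.2)) (fun p => f p.1 p.2)
  _ (within halfspace (nbhs (t, L x))) _ _ Cf).
move=> A /within_halfspace_nbhs HA; apply/within_halfspace_nbhs.
apply: filterS HA => r HA s u s0 st ux; apply: HA => //.
exact: le_trans (L1 _ _) _.
Qed.

Lemma regular_scalar_entry {m n} i j :
  regular_scalar (fun (t : R) (x : 'M[R]_(m, n)) => x i j).
Proof.
split=> [t x t0|].
  exists 1 => //; apply: nearW => r s u v *.
  by rewrite mul1r; have := ler_entry (u - v) i j; rewrite !mxE.
apply/C0_halfspaceP => t x t0; apply: cvg_within_filter.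
apply: (@cvg_comp _ _ _ snd (fun x : 'M[R]_(m, n) => x i j) _ (nbhs x)).
  exact: cvg_snd.
exact: coord_continuous.
Qed.

Lemma C1_halfspace_entry {V : normedModType R} {m n}
    (f : R -> V -> 'M[R]_(m, n)) i j :
  C1_halfspace f -> C1_halfspace (fun t x => f t x i j).
Proof.
have C0e (g : R -> V -> 'M[R]_(m, n)) :
    C0_halfspace g -> C0_halfspace (fun t x => g t x i j).
  move=> /C0_halfspaceP Cg; apply/C0_halfspaceP => t x t0.
  apply: (@cvg_comp _ _ _ (fun p => g p.1 p.2) (fun A : 'M[R]_(m, n) => A i j)
    _ (nbhs (g t x)) _ (Cg t x t0)).
  exact: coord_continuous.
move=> [ft [fx [Ht Hx Ct Cx]]].
exists (fun t x => ft t x i j), (fun v t x => fx v t x i j); split.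
- by move=> t x t0; exact: is_derivative_on_entry (Ht t x t0).
- move=> v t x t0; have [fd fl] := Hx v t x t0.
  have L : (h^-1 *: (((fun x => f t x i j) \o shift x) (h *: v) - f t x i j)
      @[h --> 0^']) --> fx v t x i j.
    rewrite -fl.
    have -> : (fun h : R => h^-1 *: (((fun x => f t x i j) \o shift x) (h *: v) - f t x i j))
       = (fun A : 'M[R]_(m, n) => A i j) \o
         (fun h => h^-1 *: ((f t \o shift x) (h *: v) - f t x)).
      by apply/funext => h /=; rewrite !mxE.
    exact: (cvg_comp _ _ fd (@coord_continuous _ m n i j _)).
  by split; [apply/cvg_ex; exists (fx v t x i j)|exact: cvg_lim].
- exact: C0e.
- by move=> v; exact: C0e.
Qed.

(** [C1_halfspace] speaks of partial derivatives only; joint continuity comes from the Lipschitz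
    bound in [x] and differentiability in [t]. *)
Lemma C1_halfspace_regular {n} (f : R -> 'cV[R]_n -> R) :
  C1_halfspace f -> regular_scalar f.
Proof.
move=> Cf; have Lf := C1_halfspace_locally_lipschitz Cf; split=> //.
apply: locally_lipschitz_C0 => // t x t0; have [ft [_ [Ht _ _ _]]] := Cf.
exact: is_derivative_on_cvg (Ht t x t0).
Qed.

Lemma locally_lipschitz_x_regular {m n} (f : R -> 'cV[R]_m -> 'cV[R]_n) i :
  locally_lipschitz_x f -> C0_halfspace f -> regular_scalar (fun t x => f t x i ord0).
Proof.
move=> Lf /C0_halfspaceP Cf; split; last first.
  apply/C0_halfspaceP => t x t0.
  apply: (@cvg_comp _ _ _ (fun p => f p.1 p.2) (fun A : 'cV[R]_n => A i ord0)
    _ (nbhs (f t x)) _ (Cf t x t0)).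
  exact: coord_continuous.
move=> t x t0; have [r [K [r0 HK]]] := Lf t x t0.
(* The absolute value is there because the sign of [K] is not prescribed; the factor [m.+1] converts
   the Euclidean norm to the max norm. *)
exists (`|K| * m.+1%:R); first exact: mulr_ge0.
near=> d => s u v s0 st ux vx.
have d0 : 0 < d by near: d; exact: nbhs_right_gt.
have dr : d < r by near: d; exact: nbhs_right_lt.
have dmr : d < r / m.+1%:R by near: d; apply: nbhs_right_lt; rewrite divr_gt0.
have le_r (w : 'cV[R]_m) : `|w - x| <= d -> enorm (w - x) <= r.
  move=> wx; apply: le_trans (enorm_le_norm _) _.
  by rewrite mulrC -ler_pdivlMr// (le_trans wx)// ltW.
have := HK s u v s0 (le_trans st (ltW dr)) (le_r _ ux) (le_r _ vx).
move=> H; have := ler_entry (f s u - f s v) i ord0; rewrite !mxE => /le_trans; apply.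
apply: le_trans (norm_le_enorm _) _; apply: le_trans H _.
apply: (@le_trans _ _ (`|K| * enorm (u - v))).
  by rewrite ler_wpM2r ?enorm_ge0// ler_norm.
by rewrite -mulrA ler_wpM2l// enorm_le_norm.
Unshelve. all: by end_near. Qed.

Lemma regular_mx {V : normedModType R} {m n} (f : R -> V -> 'M[R]_(m, n)) :
  (forall i j, regular_scalar (fun t x => f t x i j)) ->
  locally_lipschitz f /\ C0_halfspace f.
Proof.
move=> H; split; last first.
  apply/C0_halfspaceP => t x t0; apply: cvg_mx => i j.
  by have [_ /C0_halfspaceP] := H i j; exact.
move=> t x t0.
have /choice[k Hk] : forall ij : 'I_m * 'I_n, exists K, 0 <= K /\
    \forall r \near 0^'+, forall s u v,
    0 <= s -> `|s - t| <= r -> `|u - x| <= r -> `|v - x| <= r ->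
    `|f s u ij.1 ij.2 - f s v ij.1 ij.2| <= K * `|u - v|.
  by move=> [i j]; have [L _] := H i j; have [K] := L t x t0; exists K.
pose K := \sum_ij k ij.
have K0 : 0 <= K by apply: sumr_ge0 => ij _; have [] := Hk ij.
exists K => //.
have : \forall r \near 0^'+, forall ij : 'I_m * 'I_n, forall s u v,
    0 <= s -> `|s - t| <= r -> `|u - x| <= r -> `|v - x| <= r ->
    `|f s u ij.1 ij.2 - f s v ij.1 ij.2| <= k ij * `|u - v|.
  by apply: filter_forall => ij; have [] := Hk ij.
apply: filterS => r Hr s u v s0 st ux vx.
apply: mx_norm_le => [|i j]; first exact: mulr_ge0.
rewrite !mxE (le_trans (Hr (i, j) s u v s0 st ux vx))// ler_wpM2r//.
by rewrite /K (bigD1 (i, j))//= lerDl sumr_ge0// => ij _; have [] := Hk ij.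
Qed.

Lemma norm_usubmx_le {m1 m2 n} (u : 'M[R]_(m1 + m2, n)) : `|usubmx u| <= `|u|.
Proof. by apply: mx_norm_le => // i j; rewrite mxE; exact: ler_entry. Qed.

(** The entries are built from regular scalars by sums and products. The Lipschitz part yields
    uniqueness of trajectories, the continuity part that of the observer fields. *)
Lemma triangular_field_regular {n1 n2} (f1 : R -> 'cV[R]_n1 -> 'cV[R]_n1)
    (f2 : R -> 'cV[R]_n1 -> 'cV[R]_n2 -> 'cV[R]_n2)
    (a : R -> 'cV[R]_n1 -> R) (B : R -> 'cV[R]_n1 -> 'M[R]_(n1, n2)) :
  C0_halfspace f1 -> locally_lipschitz_x f1 ->
  C0_halfspace (fun t (x : 'cV[R]_(n1 + n2)) => f2 t (usubmx x) (dsubmx x)) ->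
  locally_lipschitz_x (fun t (x : 'cV[R]_(n1 + n2)) => f2 t (usubmx x) (dsubmx x)) ->
  C1_halfspace a -> C1_halfspace B ->
  locally_lipschitz (triangular_field f1 f2 a B) /\
  C0_halfspace (triangular_field f1 f2 a B).
Proof.
move=> Cf1 Lf1 Cf2 Lf2 Ca CB; apply: regular_mx => i j; rewrite (ord1 j) {j}.
have usub1 : forall u v : 'cV[R]_(n1 + n2), `|usubmx u - usubmx v| <= `|u - v|.
  by move=> u v; rewrite -linearB norm_usubmx_le.
rewrite -(splitK i); case: (fintype.split i) => k /=; last first.
  under eq_fun do under eq_fun do rewrite col_mxEd.
  exact: (locally_lipschitz_x_regular k Lf2 Cf2).
under eq_fun do under eq_fun do rewrite col_mxEu !mxE.
apply: (@regular_scalarD _ (fun t (x : 'cV[R]_(n1 + n2)) => f1 t (usubmx x) k ord0)).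
  exact: (regular_scalar_comp usub1 (locally_lipschitz_x_regular k Lf1 Cf1)).
apply: (@regular_scalarM _ (fun t (x : 'cV[R]_(n1 + n2)) => a t (usubmx x))).
  exact: (regular_scalar_comp usub1 (C1_halfspace_regular Ca)).
apply: regular_scalar_sum => j.
apply: (@regular_scalarM _ (fun t (x : 'cV[R]_(n1 + n2)) => B t (usubmx x) k j)).
  have CBkj := C1_halfspace_regular (C1_halfspace_entry k j CB).
  exact: (regular_scalar_comp usub1 CBkj).
under eq_fun do under eq_fun do rewrite mxE.
exact: regular_scalar_entry.
Qed.

End RegularFields.

(** * Gronwall's inequality and uniqueness of trajectories *)

Section Gronwall.
Context {R : realType}.

Lemma is_derivative_on_cst {V : normedModType R} (J : set R) (c : V) (t : R) :
  is_derivative_on J (fun=> c) t 0.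
Proof.
rewrite /is_derivative_on; under eq_fun do rewrite subrr scaler0.
exact: cvg_cst.
Qed.

Lemma is_derivative_onM (J : set R) (f g : R -> R) t k l :
  is_derivative_on J f t k -> is_derivative_on J g t l ->
  is_derivative_on J (fun s => f s * g s) t (k * g t + f t * l).
Proof.
move=> Hf Hg; rewrite /is_derivative_on.
have -> : (fun s => (s - t)^-1 *: (f s * g s - f t * g t)) =
   (fun s => (s - t)^-1 *: (f s - f t) * g t + f s * ((s - t)^-1 *: (g s - g t))).
  by apply/funext => s; rewrite /GRing.scale/=; ring.
(* The quotients converge along the punctured neighbourhood, so the continuity of [f] has to be
   restricted to it. *)
have Hft : f @ within J t^' --> f t.
  move=> A /(is_derivative_on_cvg Hf) HA.
  change (nbhs t (fun s => s != t -> J s -> A (f s))).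
  by apply: (@filterS _ (nbhs t) _ (fun s => J s -> A (f s))) => [s /= H _|//].
exact: (cvgD (cvgM Hf (cvg_cst (g t))) (cvgM Hft Hg)).
Qed.

Lemma is_derivative_on_sum n (J : set R) (f : 'I_n -> R -> R) df t :
  (forall i, is_derivative_on J (f i) t (df i)) ->
  is_derivative_on J (fun s => \sum_i f i s) t (\sum_i df i).
Proof.
move=> H; have -> : (fun s => \sum_i f i s) = \sum_i f i.
  by apply/funext => s; rewrite fct_sumE.
elim/big_ind2 : _ => [|f1 d1 f2 d2|i _]; last exact: H.
- exact: is_derivative_on_cst.
- exact: is_derivative_onD.
Qed.

(** The product [V * expR (- C)] has a nonpositive derivative inside the interval. [C] is a
    primitive of the rate [c], whose sign is arbitrary. *)
Lemma gronwall (V dV C c : R -> R) (a b : R) : a <= b ->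
  {within `[a, b], continuous V} -> {within `[a, b], continuous C} ->
  (forall t, a < t < b -> is_derive t 1 V (dV t)) ->
  (forall t, a < t < b -> is_derive t 1 C (c t)) ->
  (forall t, a < t < b -> dV t <= c t * V t) ->
  V b <= V a * expR (C b - C a).
Proof.
move=> ab /subspace_continuousP cV /subspace_continuousP cC dVt dCt le.
pose W t := V t * expR (- C t).
have : W b <= W a.
  apply: (@derive_le0_le _ W (fun t => (dV t - c t * V t) * expR (- C t))) => //.
    apply/subspace_continuousP => t tab; apply: cvgM; first exact: cV.
    exact: (cvg_comp _ _ (cvgN (cC _ tab)) (@continuous_expR R _)).
  move=> t tab; split; last first.
    by rewrite mulr_le0_ge0 ?expR_ge0// subr_le0; exact: le.
  have VD := dVt t tab; have CD := dCt t tab.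
  apply: is_derive_eq.
  rewrite /GRing.scale/=; ring.
rewrite /W => /(ler_wpM2r (expR_ge0 (C b))).
by rewrite -!mulrA -!expRD addNr expR0 mulr1 [- _ + _]addrC.
Qed.

(** Turns a Lipschitz bound in the max norm into a differential inequality for the sum of squares:
    each of the [n] products is at most [K] times the whole sum. *)
Lemma norm_mulr_le_sum_sq {n} (x y : 'cV[R]_n) (K : R) : 0 <= K -> `|y| <= K * `|x| ->
  \sum_i (x i ord0 * y i ord0) <= n%:R * K * \sum_i x i ord0 ^+ 2.
Proof.
move=> K0 yx; rewrite -enormE -mulrA.
rewrite -[n in n%:R]card_ord mulr_natl -sumr_const; apply: ler_sum => i _.
rewrite (le_trans (ler_norm _))// normrM expr2 mulrCA.
apply: ler_pM => //.
  by rewrite (le_trans (ler_entry _ _ _))// norm_le_enorm.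
by rewrite (le_trans (ler_entry _ _ _))// (le_trans yx)// ler_wpM2l ?norm_le_enorm.
Qed.

(** Let [s] be the last time up to [t1] at which the two trajectories meet. On a short interval
    after [s] a local Lipschitz constant is valid, and Gronwall's inequality for the squared
    distance makes them meet again later. *)
Lemma trajectory_unique {n} (F : R -> 'cV[R]_n -> 'cV[R]_n) t0 x0 x y :
  locally_lipschitz F -> 0 <= t0 -> trajectory F t0 x0 x -> trajectory F t0 x0 y ->
  forall t, t0 <= t -> x t = y t.
Proof.
move=> LF t00 [x0E Hx] [y0E Hy] t1 t01; apply: contrapT => neq.
pose S := [set t | t0 <= t <= t1 /\ x t = y t].
have S0 : S t0 by rewrite /S/= lexx t01 x0E y0E.
have Sub : ubound S t1 by move=> t [/andP[]].
have hS : has_sup S by split; [exists t0|exists t1].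
set s := sup S.
have t0s : t0 <= s by apply: ub_le_sup => //; exists t1.
have s1 : s <= t1 by apply: ge_sup => //; exists t0.
have Js : `[t0, +oo[%classic s by rewrite /= in_itv/= t0s.
have cx := is_derivative_on_cvg (Hx s Js).
have cy := is_derivative_on_cvg (Hy s Js).
(* The supremum is attained: a gap at [s] would persist near [s] by continuity, where [S] has
   points. *)
have xys : x s = y s.
  apply: contrapT => xy.
  have d0 : 0 < `|x s - y s| / 2.
    by rewrite divr_gt0// normr_gt0 subr_eq0; exact/eqP.
  have cxy : (fun t => x t - y t) @ within `[t0, +oo[ (nbhs s) --> x s - y s.
    exact: cvgB.
  have /cvgrPdist_lt/(_ _ d0)/nbhs_normP[d /= d_gt0 Hd] := cxy.
  have [t [/andP[t0t tt1] xyt] st] := sup_adherent d_gt0 hS.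
  have ts : t <= s by apply: ub_le_sup; [exists t1|rewrite /S/= t0t tt1].
  have := Hd t; rewrite /= xyt subrr subr0 in_itv/= t0t.
  rewrite ger0_norm ?subr_ge0// => H.
  have /H/(_ isT) : s - t < d by rewrite ltrBlDr -ltrBlDl.
  lra.
have s_lt : s < t1.
  by rewrite lt_neqAle s1 andbT; apply/eqP => sE; apply: neq; rewrite -sE.
have [K K0 HK] := LF s (x s) (le_trans t00 t0s).
near (0 : R)^'+ => r.
have r0 : 0 < r by near: r; exact: nbhs_right_gt.
have HKr : forall t u v,
    0 <= t -> `|t - s| <= r -> `|u - x s| <= r -> `|v - x s| <= r ->
    `|F t u - F t v| <= K * `|u - v| by near: r.
have /cvgrPdist_le/(_ _ r0)/nbhs_normP[dx /= dx0 Hdx] := cx.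
have /cvgrPdist_le/(_ _ r0)/nbhs_normP[dy /= dy0 Hdy] := cy.
near (0 : R)^'+ => d.
have d0 : 0 < d by near: d; exact: nbhs_right_gt.
have ddx : d < dx by near: d; exact: nbhs_right_lt.
have ddy : d < dy by near: d; exact: nbhs_right_lt.
have dr : d < r by near: d; exact: nbhs_right_lt.
have sd1 : s + d < t1 by rewrite -ltrBrDl; near: d; apply: nbhs_right_lt; rewrite subr_gt0.
have sJ : `[s, s + d] `<=` `[t0, +oo[.
  by move=> t /=; rewrite !in_itv/= andbT => /andP[/(le_trans t0s)].
pose V t := \sum_i (x t - y t) i ord0 ^+ 2.
pose dV t := 2 * \sum_i ((x t - y t) i ord0 * (F t (x t) - F t (y t)) i ord0).
have HV t : `[s, s + d]%classic t -> is_derivative_on `[s, s + d] V t (dV t).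
  move=> tsd; rewrite /dV mulr_sumr; apply: is_derivative_on_sum => i.
  have := is_derivative_onB (Hx t (sJ t tsd)) (Hy t (sJ t tsd)).
  move=> /(is_derivative_on_subset sJ)/(is_derivative_on_entry (i := i) (j := ord0)) H.
  rewrite (_ : 2 * _ = (F t (x t) - F t (y t)) i ord0 * (x t - y t) i ord0 +
    (x t - y t) i ord0 * (F t (x t) - F t (y t)) i ord0).
    exact: (is_derivative_onM H H).
  ring.
have ssd : s <= s + d by rewrite lerDl ltW.
have : V (s + d) <= 0.
  (* As [V s = 0], the Gronwall bound with constant rate [2 * (n * K)] vanishes. *)
  have -> : 0 = V s * expR (2 * (n%:R * K) * (s + d) - 2 * (n%:R * K) * s).
    by rewrite /V big1 ?mul0r// => i _; rewrite xys subrr mxE expr0n.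
  apply: (@gronwall V dV (fun t => 2 * (n%:R * K) * t) (fun=> 2 * (n%:R * K))) => //.
  - exact: is_derivative_on_continuous HV.
  - by apply: continuous_subspaceT => t; apply: cvgMr; exact: cvg_id.
  - move=> t tsd; apply: is_derivative_on_is_derive (nbhs_oo tsd) (HV t _).
    by move/andP: tsd => [? ?]; rewrite /= in_itv/= !ltW.
  - by move=> t _; apply: is_derive_eq; rewrite /GRing.scale/= mulr1.
  move=> t /andP[st tsd]; rewrite -mulrA ler_wpM2l//.
  apply: norm_mulr_le_sum_sq => //.
  have tJ : t0 <= t by rewrite (le_trans t0s)// ltW.
  have ts_d : `|s - t| < d by rewrite ltr0_norm ?subr_lt0// opprB ltrBlDl.
  apply: HKr.
  - exact: le_trans tJ.
  - by rewrite distrC (le_trans (ltW ts_d))// ltW.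
  - rewrite distrC; apply: (Hdx t) => /=; last by rewrite in_itv/= tJ.
    exact: lt_trans ddx.
  - rewrite distrC xys; apply: (Hdy t) => /=; last by rewrite in_itv/= tJ.
    exact: lt_trans ddy.
rewrite -[V _]/(\sum_i _) -enormE => V0.
have e0 : enorm (x (s + d) - y (s + d)) = 0.
  by apply/eqP; rewrite -sqrf_eq0 eq_le V0 sqr_ge0.
have : s + d <= s.
  apply: ub_le_sup; [by exists t1|split].
    by rewrite (le_trans t0s ssd) (ltW sd1).
  apply/eqP; rewrite -subr_eq0 -normr_eq0 eq_le normr_ge0 andbT -e0.
  exact: norm_le_enorm.
by rewrite gerDl leNgt d0.
Unshelve. all: by end_near. Qed.

End Gronwall.

(** * Quadratic forms and the induced matrix norm *)

Section QuadraticForms.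
Context {R : realType}.

(** Cauchy-Schwarz, by expanding the squares of [x i * enorm y - y i * enorm x]. *)
Lemma sum_mul_le_enorm {n} (x y : 'cV[R]_n) :
  \sum_i x i ord0 * y i ord0 <= enorm x * enorm y.
Proof.
have [x0|x0] := eqVneq (enorm x) 0.
  have /eqP : `|x| = 0 by apply/eqP; rewrite eq_le normr_ge0 andbT -x0 norm_le_enorm.
  rewrite normr_eq0 => /eqP ->; rewrite enorm0 mul0r.
  by rewrite big1// => i _; rewrite mxE mul0r.
have [y0|y0] := eqVneq (enorm y) 0.
  have /eqP : `|y| = 0 by apply/eqP; rewrite eq_le normr_ge0 andbT -y0 norm_le_enorm.
  rewrite normr_eq0 => /eqP ->; rewrite enorm0 mulr0.
  by rewrite big1// => i _; rewrite mxE mulr0.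
set c := enorm x; set d := enorm y; set S := \sum_i _.
have cd0 : 0 < c * d.
  by rewrite mulr_gt0// lt_neqAle eq_sym ?x0 ?y0 enorm_ge0.
have : 0 <= \sum_i (x i ord0 * d - y i ord0 * c) ^+ 2.
  by apply: sumr_ge0 => i _; rewrite sqr_ge0.
have -> : \sum_i (x i ord0 * d - y i ord0 * c) ^+ 2 =
    c ^+ 2 * d ^+ 2 + d ^+ 2 * c ^+ 2 - 2 * (c * d) * S.
  rewrite [X in X * _ + _]enormE [X in _ + X * _ - _]enormE /S.
  rewrite 2!mulr_suml mulr_sumr -big_split -sumrB/=.
  by apply: eq_bigr => i _; ring.
rewrite subr_ge0 (_ : _ + _ = 2 * (c * d) * (c * d)); last by ring.
by rewrite ler_pM2l// mulr_gt0.
Qed.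

Lemma qformE {n} (A : 'M[R]_n) (e : 'cV[R]_n) :
  qform A e = \sum_i e i ord0 * (A *m e) i ord0.
Proof. by rewrite /qform -mulmxA mxE; apply: eq_bigr => i _; rewrite mxE. Qed.

Lemma enormZ {n} (c : R) (x : 'cV[R]_n) : enorm (c *: x) = `|c| * enorm x.
Proof.
rewrite /enorm -sqrtr_sqr -sqrtrM ?sqr_ge0// mulr_sumr; congr Num.sqrt.
by apply: eq_bigr => i _; rewrite mxE exprMn.
Qed.

Lemma enorm_mulmx_le {m n} (A : 'M[R]_(m, n)) (e : 'cV[R]_n) :
  enorm (A *m e) <= opnorm A * enorm e.
Proof.
have [e0|e0] := eqVneq (enorm e) 0.
  have /eqP : `|e| = 0 by apply/eqP; rewrite eq_le normr_ge0 andbT -e0 norm_le_enorm.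
  by rewrite normr_eq0 => /eqP ->; rewrite mulmx0 !enorm0 mulr0.
have e_gt0 : 0 < enorm e by rewrite lt_neqAle eq_sym e0 enorm_ge0.
pose u := (enorm e)^-1 *: e.
have u1 : enorm u = 1.
  by rewrite enormZ normfV ger0_norm ?enorm_ge0// mulVf.
have -> : A *m e = enorm e *: (A *m u).
  by rewrite -scalemxAr scalerA mulfV// scale1r.
rewrite enormZ ger0_norm ?enorm_ge0// mulrC ler_pM2r//.
apply: ub_le_sup; last by exists u.
(* Any bound does: it only shows that the set is bounded, so that its [sup] is an upper bound. *)
exists (m.+1%:R * (n%:R * `|A|)) => _ [v /= v1 <-].
apply: le_trans (enorm_le_norm _) _; rewrite ler_wpM2l//.
apply: mx_norm_le => [|i j]; first exact: mulr_ge0.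
rewrite mxE (le_trans (ler_norm_sum _ _ _))//.
rewrite -[n in n%:R]card_ord mulr_natl -sumr_const; apply: ler_sum => k _.
rewrite normrM -[leRHS]mulr1; apply: ler_pM => //; first exact: ler_entry.
by rewrite -v1 (le_trans (ler_entry _ _ _))// norm_le_enorm.
Qed.

Lemma qform_le_opnorm {n} (A : 'M[R]_n) (e : 'cV[R]_n) :
  qform A e <= opnorm A * enorm e ^+ 2.
Proof.
rewrite qformE (le_trans (sum_mul_le_enorm _ _))//.
by rewrite expr2 mulrA [opnorm A * _]mulrC -mulrA ler_wpM2l ?enorm_ge0 ?enorm_mulmx_le.
Qed.

Lemma qform1 {n} (e : 'cV[R]_n) : qform 1%:M e = enorm e ^+ 2.
Proof. by rewrite qformE mul1mx enormE; apply: eq_bigr => i _; rewrite expr2. Qed.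

(** Symmetry of [P t] merges the two terms in which [e] is differentiated, since a 1 by 1 matrix
    equals its transpose. *)
Lemma is_derivative_on_qform {n} (J : set R) (P : R -> 'M[R]_n) (e : R -> 'cV[R]_n)
    t dP de : (P t)^T = P t ->
  is_derivative_on J P t dP -> is_derivative_on J e t de ->
  is_derivative_on J (fun s => qform (P s) (e s)) t
    (2 * ((e t)^T *m (P t *m de)) ord0 ord0 + qform dP (e t)).
Proof.
move=> Psym HP He.
have -> : (fun s => qform (P s) (e s)) =
    (fun s => \sum_i e s i ord0 * \sum_j P s i j * e s j ord0).
  by apply/funext => s; rewrite qformE; apply: eq_bigr => i _; rewrite mxE.
have Hi i := is_derivative_on_entry (i := i) (j := ord0) He.
have Hij i j := is_derivative_on_entry (i := i) (j := j) HP.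
have H := is_derivative_on_sum (fun i => is_derivative_onM (Hi i)
   (is_derivative_on_sum (fun j => is_derivative_onM (Hij i j) (Hi j)))).
rewrite (_ : _ + _ = \sum_i (de i ord0 * (\sum_j P t i j * e t j ord0) +
   e t i ord0 * (\sum_j (dP i j * e t j ord0 + P t i j * de j ord0)))) //.
rewrite big_split/=.
have -> : \sum_i e t i ord0 * \sum_j (dP i j * e t j ord0 + P t i j * de j ord0) =
    qform dP (e t) + ((e t)^T *m (P t *m de)) ord0 ord0.
  rewrite qformE [X in _ = _ + X]mxE -big_split/=; apply: eq_bigr => i _.
  by rewrite big_split/= mulrDr !mxE.
have -> : \sum_i de i ord0 * \sum_j P t i j * e t j ord0 =
    ((e t)^T *m (P t *m de)) ord0 ord0.
  rewrite [X in _ = X](_ : _ = ((e t)^T *m (P t *m de))^T ord0 ord0); last by rewrite [RHS]mxE.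
  rewrite !trmx_mul Psym trmxK -mulmxA mxE.
  by apply: eq_bigr => i _; rewrite !mxE.
ring.
Qed.

End QuadraticForms.

(** * Decay of the difference of two trajectories with the same output *)

Section Detectability.
Context {R : realType}.

(** A nonempty open interval has positive measure, so it is not contained in a null set. *)
Lemma ae_exists_itv (P : R -> Prop) (a p q : R) :
  {ae lebesgue_measure, forall t, a <= t -> P t} -> a <= p -> p < q ->
  exists2 t, p < t < q & P t.
Proof.
move=> [A [mA A0 NA]] ap pq; apply: contrapT => nP.
have sub : `]p, q[ `<=` A.
  move=> t /=; rewrite in_itv/= => tpq; apply: NA => /= H.
  apply: nP; exists t => //; apply: H; move/andP: tpq => [pt _].
  exact: le_trans (ltW pt).
have : (lebesgue_measure (`]p, q[%classic : set R) <= 0)%E.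
  by rewrite -A0; apply: le_measure; rewrite ?inE.
rewrite lebesgue_measure_itv /= lte_fin pq -EFinB lee_fin.
by rewrite leNgt subr_gt0 pq.
Qed.

Lemma C0_halfspace_comp {V W : normedModType R} (f : R -> V -> W) (w : R -> V)
    (J : set R) (t : R) : C0_halfspace f -> J `<=` [set s | 0 <= s] -> J t ->
  w @ within J (nbhs t) --> w t ->
  (fun s => f s (w s)) @ within J (nbhs t) --> f t (w t).
Proof.
move=> /C0_halfspaceP Cf J0 Jt cw A /(Cf t (w t) (J0 t Jt)).
move=> /within_halfspace_nbhs HA.
change (nbhs t (fun s => J s -> A (f s (w s)))).
near (0 : R)^'+ => r.
have r0 : 0 < r by near: r; exact: nbhs_right_gt.
have HAr : forall s u, 0 <= s -> `|s - t| <= r -> `|u - w t| <= r -> A (f s u).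
  by near: r.
have /cvgrPdist_le/(_ _ r0)/nbhs_normP[d /= d0 Hd] := cw.
apply/nbhs_normP; exists (Num.min r d) => /=; first by rewrite lt_min r0.
move=> s /=; rewrite lt_min => /andP[sr sd] Js; apply: HAr.
- exact: J0.
- by rewrite distrC ltW.
- by rewrite distrC; exact: Hd.
Unshelve. all: by end_near. Qed.

(** At the infimum [s] of the times where [c <= N], all earlier values are below [c], so the
    hypothesis gives [N s < c]; by continuity this persists just after [s], against the choice of
    [s]. *)
Lemma continuation_lt (N : R -> R) (c a b : R) :
  {within `[a, b], continuous N} ->
  (forall s, a <= s <= b -> (forall t, a <= t < s -> N t < c) -> N s < c) ->
  forall t, a <= t <= b -> N t < c.
Proof.
move=> /subspace_continuousP cN H t1 t1ab; rewrite ltNge; apply/negP => cN1.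
pose S := [set t | a <= t <= b /\ c <= N t].
have hS : has_inf S by split; [exists t1|exists a => t [/andP[]]].
set s := inf S.
have as_ : a <= s by apply: lb_le_inf hS.1 _ => t [/andP[]].
have sb : s <= b.
  by rewrite (le_trans (ge_inf hS.2 (conj t1ab cN1 : S t1)))//; case/andP: t1ab.
have sab : a <= s <= b by rewrite as_ sb.
have Ns : N s < c.
  apply: H => // t /andP[at_ ts]; rewrite ltNge; apply/negP => cNt.
  have : S t by split; rewrite // at_ (le_trans (ltW ts)).
  by move/(ge_inf hS.2); rewrite leNgt ts.
have d0 : 0 < c - N s by rewrite subr_gt0.
have /cN/cvgrPdist_lt/(_ _ d0)/nbhs_normP[d /= d_gt0 Hd] : `[a, b]%classic s.
  by rewrite /= in_itv.
have [t [tab cNt] td] := inf_adherent d_gt0 hS.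
have st : s <= t by apply: ge_inf hS.2 _ _.
have := Hd t; rewrite /= in_itv/= tab distrC ger0_norm ?subr_ge0//.
rewrite ltrBlDl => /(_ td isT); rewrite ltr_norml /from_subspace => /andP[? _]; lra.
Qed.

(** The fundamental theorem of calculus, in the form in which [gronwall] takes its exponent. *)
Lemma Rintegral_derive (d : R -> R) (a b : R) : a <= b ->
  {within `[a, b], continuous d} ->
  let I t := \int[lebesgue_measure]_(s in `[a, t]) d s in
  {within `[a, b], continuous I} /\
  (forall t, a < t < b -> is_derive t 1 I (d t)).
Proof.
move=> ab cd I.
have di : lebesgue_measure.-integrable `[a, b] (EFin \o d).
  by apply: continuous_compact_integrable cd; exact: segment_compact.
split; first exact: parameterized_integral_continuous ab di.
move=> t /andP[at_ tb].
have ct : {for t, continuous d}.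
  apply: (within_continuous_continuous (lt_trans at_ tb) cd).
  by rewrite in_itv/= at_.
have [Id Ie] := continuous_FTC1_closed tb di at_ ct.
by split => //; rewrite -derive1E.
Qed.

(** The differential inequality is available only while [enorm (e t) <= xi]. As long as this holds,
    Gronwall's inequality for [V = e' P e], with [P >= I] and [opnorm (P a) <= L], gives the claimed
    bound; as [I > - eps], that bound is strictly below [xi ^+ 2], so the error never reaches
    [xi]. *)
Lemma weighted_decay {n} (a b L eps xi : R) (P dP : R -> 'M[R]_n)
    (e de : R -> 'cV[R]_n) (d : R -> R) :
  let I t := \int[lebesgue_measure]_(s in `[a, t]) d s in
  a <= b -> 0 <= L -> 0 < xi ->
  (forall t, a <= t <= b -> is_derivative_on `[a, b] P t (dP t)) ->
  (forall t, a <= t <= b -> is_derivative_on `[a, b] e t (de t)) ->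
  {within `[a, b], continuous d} ->
  (forall t, a <= t <= b -> (P t)^T = P t /\ loewner_le 1%:M (P t)) ->
  opnorm (P a) <= L ->
  (forall t, a <= t <= b -> - eps < I t) ->
  L * enorm (e a) ^+ 2 * expR (2 * eps) < xi ^+ 2 ->
  (forall t, a < t < b -> enorm (e t) <= xi ->
     ((e t)^T *m (P t *m de t)) ord0 ord0 + 2^-1 * qform (dP t) (e t)
       <= - d t * qform (P t) (e t)) ->
  forall t, a <= t <= b ->
    enorm (e t) ^+ 2 <= L * enorm (e a) ^+ 2 * expR (- 2 * I t).
Proof.
move=> I ab L0 xi0 HP He cd Pprop PL Ieps Lxi dec.
have Ia : I a = 0 by rewrite /I set_itv1 Rintegral_set1.
pose V t := qform (P t) (e t).
have decay s : a <= s <= b -> (forall t, a <= t < s -> enorm (e t) ^+ 2 < xi ^+ 2) ->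
    enorm (e s) ^+ 2 <= L * enorm (e a) ^+ 2 * expR (- 2 * I s).
  move=> sab small; have /andP[as_ sb] := sab.
  have sub : `[a, s] `<=` `[a, b].
    by move=> t /=; rewrite !in_itv/= => /andP[-> /le_trans ->].
  have [_ P1] := Pprop s sab.
  apply: (@le_trans _ _ (V s)); first by rewrite -qform1; exact: P1.
  apply: (@le_trans _ _ (V a * expR (- 2 * I s))); last first.
    rewrite ler_wpM2r ?expR_ge0// (le_trans (qform_le_opnorm _ _))//.
    by rewrite ler_wpM2r ?sqr_ge0.
  have [cI dI] := Rintegral_derive as_ (continuous_subspaceW sub cd).
  have VD t : a <= t <= s -> is_derivative_on `[a, s] V t
      (2 * ((e t)^T *m (P t *m de t)) ord0 ord0 + qform (dP t) (e t)).
    move=> /andP[at_ ts]; have tab : a <= t <= b by rewrite at_ (le_trans ts).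
    apply: (is_derivative_on_subset sub); apply: is_derivative_on_qform.
    - by have [] := Pprop t tab.
    - exact: HP.
    - exact: He.
  have -> : - 2 * I s = - 2 * I s - - 2 * I a by rewrite Ia mulr0 subr0.
  apply: (@gronwall _ V (fun t => 2 * ((e t)^T *m (P t *m de t)) ord0 ord0
    + qform (dP t) (e t)) (fun t => - 2 * I t) (fun t => - 2 * d t)) => //.
  - by apply: is_derivative_on_continuous => t /=; rewrite in_itv/=; exact: VD.
  - move: cI => /subspace_continuousP cI; apply/subspace_continuousP => t tas.
    by apply: cvgMr; exact: cI.
  - move=> t tas; apply: is_derivative_on_is_derive (nbhs_oo tas) (VD t _).
    by case/andP: tas => ? ?; rewrite !ltW.
  - move=> t tas; have Id := dI t tas.
    apply: is_derive_eq; rewrite /GRing.scale/=; ring.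
  move=> t /andP[at_ ts].
  have tab : a < t < b by rewrite at_ (lt_le_trans ts).
  have e_le : enorm (e t) <= xi.
    rewrite -(@ler_sqr R) ?nnegrE ?enorm_ge0 ?(ltW xi0)// ltW// small//.
    by rewrite (ltW at_).
  have := dec t tab e_le.
  by rewrite -/(V t) => H; lra.
(* Continuation: smallness before [s] gives the decay bound at [s], which gives smallness at [s]. *)
have small : forall t, a <= t <= b -> enorm (e t) ^+ 2 < xi ^+ 2.
  apply: continuation_lt => [|s sab /(decay s sab) H].
    have D t : `[a, b]%classic t -> is_derivative_on `[a, b] (fun t => enorm (e t) ^+ 2) t
       (2 * ((e t)^T *m (1%:M *m de t)) ord0 ord0 + qform 0 (e t)).
      move=> tab.
      have -> : (fun t => enorm (e t) ^+ 2) = (fun t => qform 1%:M (e t)).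
        by apply/funext => u; rewrite qform1.
      apply: is_derivative_on_qform; rewrite ?trmx1//.
        exact: is_derivative_on_cst.
      by apply: He; move: tab; rewrite /= in_itv.
    exact: is_derivative_on_continuous D.
  apply: le_lt_trans H _; apply: (le_lt_trans _ Lxi).
  apply: ler_wpM2l; first by rewrite mulr_ge0 ?sqr_ge0.
  by rewrite ler_expR; have := Ieps s sab; lra.
move=> t /[dup] tab /andP[at_ tb]; apply: decay => // s /andP[as_ st].
by apply: small; rewrite as_ (le_trans (ltW st)).
Qed.

(** Inside the interval the difference of the outputs is constantly [0], so its derivative vanishes;
    the [f1] terms cancel and [a B e = 0] remains. Hence [B e = 0] wherever [a] is nonzero, in
    particular on a dense set, and continuity extends this to all of [[t0, T]], endpoints
    included. *)
Lemma same_output_kernel {n1 n2} (f1 : R -> 'cV[R]_n1 -> 'cV[R]_n1)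
    (f2 : R -> 'cV[R]_n1 -> 'cV[R]_n2 -> 'cV[R]_n2)
    (a : R -> 'cV[R]_n1 -> R) (B : R -> 'cV[R]_n1 -> 'M[R]_(n1, n2))
    (t0 T : R) (x w : R -> 'cV[R]_(n1 + n2)) :
  let F := triangular_field f1 f2 a B in
  C1_halfspace B -> 0 <= t0 -> t0 < T ->
  ode_solution `[t0, +oo[ F x -> ode_solution `[t0, +oo[ F w ->
  {ae lebesgue_measure, forall t, t0 <= t -> a t (usubmx (x t)) != 0} ->
  (forall t, t0 <= t <= T -> usubmx (x t) = usubmx (w t)) ->
  forall t, t0 <= t <= T ->
    B t (usubmx (x t)) *m (dsubmx (x t) - dsubmx (w t)) = 0.
Proof.
move=> F CB t00 tT Hx Hw a_neq0 xw.
pose e t := dsubmx (x t) - dsubmx (w t).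
have sub : `[t0, T] `<=` `[t0, +oo[.
  by move=> t /=; rewrite !in_itv/= => /andP[->].
have key t i : t0 < t < T -> a t (usubmx (x t)) != 0 ->
    (B t (usubmx (x t)) *m e t) i ord0 = 0.
  move=> tT'; have /andP[t0t tT1] := tT' => a0.
  have tJ : `[t0, T]%classic t by rewrite /= in_itv/= !ltW.
  have := is_derivative_onB (Hx t (sub t tJ)) (Hw t (sub t tJ)).
  move=> /(is_derivative_on_subset sub).
  move=> /(is_derivative_on_entry (i := lshift n2 i) (j := ord0)) H.
  have H0 : is_derivative_on `[t0, T] (fun=> 0 : R) t
      ((F t (x t) - F t (w t)) (lshift n2 i) ord0).
    apply: is_derivative_on_eq H => // s sJ.
    have := xw s sJ => /matrixP/(_ i ord0); rewrite !mxE => ->.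
    by rewrite subrr.
  have [_ E] := is_derivative_on_is_derive (nbhs_oo tT') H0.
  have [_ E0] := is_derive_cst (0 : R) t (1 : R).
  have xwt := xw t tJ.
  have entryB (u v : 'cV[R]_(n1 + n2)) k : (u - v) k ord0 = u k ord0 - v k ord0.
    by rewrite !mxE.
  move: E; rewrite E0 entryB /F /triangular_field xwt !col_mxEu !mxE.
  rewrite opprD addrACA subrr add0r -mulrBr => /esym/eqP.
  rewrite mulf_eq0 -xwt (negbTE a0)/= -sumrB => /eqP E1.
  rewrite -[RHS]E1; apply: eq_bigr => j _; rewrite !mxE; ring.
move=> t tT'; apply/matrixP => i j; rewrite (ord1 j) {j} [RHS]mxE.
pose b s := (B s (usubmx (x s)) *m e s) i ord0.
apply: contrapT => /eqP b0; rewrite -/(e t) -/(b t) in b0.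
have tJ : `[t0, T]%classic t by rewrite /= in_itv.
have cb : b @ within `[t0, T] (nbhs t) --> b t.
  have bE : b = \sum_k (fun s => B s (usubmx (x s)) i k * e s k ord0).
    by apply/funext => s; rewrite fct_sumE /b mxE.
  have -> : b t = \sum_k (B t (usubmx (x t)) i k * e t k ord0) by rewrite /b mxE.
  have cx k := is_derivative_on_cvg (is_derivative_on_entry (i := k) (j := ord0)
    (is_derivative_on_subset sub (Hx t (sub t tJ)))).
  have cw k := is_derivative_on_cvg (is_derivative_on_entry (i := k) (j := ord0)
    (is_derivative_on_subset sub (Hw t (sub t tJ)))).
  rewrite bE; elim/big_ind2 : _ => [|? ? ? ? ? ?|k _]; first exact: cvg_cst.
    exact: cvgD.
  apply: cvgM; last first.
    by rewrite /e; under eq_fun do rewrite !mxE; rewrite !mxE; exact: cvgB.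
  have [_ CBik] := C1_halfspace_regular (C1_halfspace_entry i k CB).
  apply: (C0_halfspace_comp CBik (w := fun s => usubmx (x s))) => //.
    by move=> s /=; rewrite in_itv/= => /andP[/(le_trans t00)].
  apply: cvg_mx => k' j; rewrite (ord1 j) {j}.
  by under eq_fun do rewrite mxE; rewrite mxE; exact: cx.
have d0 : 0 < `|b t| by rewrite normr_gt0.
have /cvgrPdist_lt/(_ _ d0)/nbhs_normP[d /= d_gt0 Hd] := cb.
(* A one-sided interval at [t] inside [[t0, T]]: to the left if [t = T], to the right otherwise. *)
have [p [q [pq t0p qT near_pq]]] : exists p q, [/\ p < q, t0 <= p, q <= T &
    forall s, p < s < q -> `|t - s| < d].
  have /andP[t0t] := tT'; rewrite le_eqVlt => /predU1P[tE|tlt].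
    exists (Num.max t0 (t - d)), t; rewrite tE gt_max tT ltrBlDr ltrDl d_gt0 le_max lexx.
    split=> // s; rewrite gt_max => /andP[/andP[_ ds] sT].
    by rewrite ger0_norm ?subr_ge0 ?ltW// ltrBlDr -ltrBlDl.
  exists t, (Num.min T (t + d)); rewrite lt_min tlt ltrDl d_gt0 ge_min lexx.
  split=> // s; rewrite lt_min => /andP[ts /andP[_ sd]].
  by rewrite distrC ger0_norm ?subr_ge0 ?ltW// ltrBlDl.
have [s /andP[ps sq] as0] := ae_exists_itv a_neq0 t0p pq.
have st : t0 < s < T by rewrite (le_lt_trans t0p ps) (lt_le_trans sq qT).
have := Hd s (near_pq s _); rewrite ps sq in_itv/= => /(_ isT).
have -> : b s = 0 by exact: key.
by rewrite subr0 ltxx; case/andP: st => ? ?; rewrite !ltW// => /(_ isT).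
Qed.

End Detectability.

(** * Construction of the switching observer *)

Section SwitchingObserver.
Context {R : realType}.

Lemma is_derivative_on_mx {m n} (J : set R) (f : R -> 'M[R]_(m, n)) (t : R)
    (l : 'M[R]_(m, n)) :
  (forall i j, is_derivative_on J (fun s => f s i j) t (l i j)) ->
  is_derivative_on J f t l.
Proof.
move=> H; apply: cvg_mx => i j.
by under eq_fun do rewrite !mxE; exact: H.
Qed.

Lemma is_derivative_on_expRZ {m n} (J : set R) (c : 'M[R]_(m, n)) (k a t : R) :
  is_derivative_on J (fun s => expR (- k * (s - a)) *: c) t
    (- (k *: (expR (- k * (t - a)) *: c))).
Proof.
apply: is_derivative_on_mx => i j; under eq_fun do rewrite mxE.
apply: is_derive_is_derivative_on; apply: is_derive_eq.
rewrite !mxE /GRing.scale/=; ring.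
Qed.

(** Follows from [1 + m * N <= expR (m * N)]. The bound is free of [N]: a gain proportional to the
    size of the initial value damps it below a prescribed level. *)
Lemma expRN_mul_le (m N : R) : 0 < m -> 0 <= N -> expR (- (m * N)) * N <= m^-1.
Proof.
move=> m0 N0; rewrite expRN mulrC ler_pdivrMr ?expR_gt0// ler_pdivlMl//.
by apply: le_trans (expR_ge1Dx _); rewrite lerDr.
Qed.

(** The infimum need not be attained, hence the slack [1]. The choice is a function of the set
    alone, so equal sets give equal choices, which is what noncausality rests on; [x0] is the
    default for the empty set. *)
Lemma near_minimizer {T : Type} (x0 : T) (f : T -> R) : (forall x, 0 <= f x) ->
  exists c : set T -> T, forall S, S !=set0 ->
    S (c S) /\ forall x, S x -> f (c S) <= f x + 1.
Proof.
move=> f0; suff /choice[c Hc] : forall S : set T, exists c, S !=set0 ->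
  S c /\ forall x, S x -> f c <= f x + 1 by exists c.
move=> S.
have [[s Ss]|S0] := pselect (S !=set0); last by exists x0.
have hS : has_inf (f @` S).
  by split; [exists (f s); exists s|exists 0 => _ [x _ <-]].
have [_ [c Sc <-] fc] := inf_adherent ltr01 hS.
exists c => _; split=> // x Sx; rewrite (le_trans (ltW fc))// lerD2r.
by apply: ge_inf hS.2 _ _; exists x.
Qed.

(** Separates the observer from the error estimate. The rate [rho] may depend on [x] but neither on
    [T] nor on [w], so one rate serves all stages, each of which has its own horizon and its own
    trajectory. *)
Lemma AC_SODP_of_uniform_error {n k} (F : R -> 'cV[R]_n -> 'cV[R]_n)
    (h : R -> 'cV[R]_n -> 'cV[R]_k) (M : set 'cV[R]_n) :
  C0_halfspace F ->
  (forall t0 y x0 x, 0 <= t0 -> C0_outputs (outputs F h [set t | 0 <= t] M) t0 y ->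
     M x0 -> trajectory F t0 x0 x -> (forall t, t0 <= t -> y t = h t (x t)) ->
     exists2 rho : R -> R, rho @ +oo --> 0 &
       forall T w0 w, t0 < T -> M w0 -> enorm w0 <= enorm x0 + 1 ->
         trajectory F t0 w0 w -> (forall t, t0 <= t <= T -> h t (w t) = y t) ->
         forall t, t0 <= t <= T -> `|x t - w t| <= rho t) ->
  AC_SODP_solvable F h M.
Proof.
move=> CF err Omega t0 tau t00 tau0.
(* The truncated predecessor makes [ts 0 = ts 1 = t0]. *)
pose ts m := t0 + m.-1%:R * (tau / 2).
have tau2 : 0 < tau / 2 by rewrite divr_gt0.
have ts_ge m : t0 <= ts m by rewrite lerDl mulr_ge0// ltW.
have tsS m : (0 < m)%N -> ts m.+1 = ts m + tau / 2.
  by case: m => // m _; rewrite /ts/= -natr1 mulrDl mul1r addrA.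
have ts_pred m : ts m <= ts m.-1 + tau / 2.
  case: m => [|[|m]]; last by rewrite tsS.
    by rewrite lerDl ltW.
  by rewrite lerDl ltW.
(* The latest time to which stage [m] may look already at its first time [ts m.-1]; it covers the
   whole stage, at most two steps long. *)
pose T m := ts m.-1 + tau.
have tsT m : (0 < m)%N -> ts m.+1 <= T m.
  by move=> m0; rewrite tsS// /T; have := ts_pred m; lra.
have ts_le m : ts m.-1 <= ts m.+1.
  rewrite /ts lerD2l; apply: ler_wpM2r; first exact: ltW.
  by rewrite ler_nat (leq_trans (leq_pred _))// leq_pred.
pose S m (y : R -> 'cV[R]_k) := [set p : 'cV[R]_n * (R -> 'cV[R]_n) |
  [/\ M p.1, trajectory F t0 p.1 p.2 &
      forall t, t0 <= t <= T m -> h t (p.2 t) = y t]].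
have [c Hc] := @near_minimizer _ (0, fun=> 0) (fun p : 'cV[R]_n * (R -> 'cV[R]_n) =>
  enorm p.1) (fun p => enorm_ge0 p.1).
pose w m y := (c (S m y)).2.
(* Over one step of length [tau / 2] the exponent becomes [m] times the norm of the initial value,
   as in [expRN_mul_le]. *)
pose K m y : R := (tau / 2)^-1 * m%:R * `|w m y (ts m.-1)|.
pose r m y t := expR (- K m y * (t - ts m.-1)) *: w m y (ts m.-1).
pose z m y t := w m y t - r m y t.
(* The derivative of [z m y], since [r m y] has derivative [- K m y *: r m y]. *)
pose g m y t (_ : 'cV[R]_n) (_ : 'cV[R]_k) := F t (w m y t) + K m y *: r m y t.
exists (fun=> ts), g, (fun=> [set 0]); split=> [m m0|y yO G].
  move=> y1 y2 t _ _ /=; rewrite in_itv/= => /andP[t1 _] _ y12.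
  apply/funext => z_; apply/funext => w_; rewrite /g /r /K /w.
  (* As [t >= ts m.-1], the outputs agree up to [t + tau >= T m], which is all that [S m] sees of
     them. *)
  suff -> : S m y1 = S m y2 by [].
  apply/seteqP; split=> p [Mp Fp Hp]; split=> // s /[dup] /Hp -> /andP[ss sT];
    rewrite y12//; apply: le_trans sT _; exact: lerD.
have [[_ [x1 [x1' [Mx1 Fx1 yx1]]]] _] := yO.
have Sy m : S m y !=set0.
  by exists (x1, x1'); split=> // t /andP[tt _]; exact: (esym (yx1 t tt)).
have Fw m : trajectory F t0 (c (S m y)).1 (w m y) by have [[]] := Hc _ (Sy m).
have sub m : (0 < m)%N -> `[ts m.-1, ts m.+1] `<=` `[t0, +oo[.
  by move=> m0 t /=; rewrite !in_itv/= andbT => /andP[/(le_trans (ts_ge _))].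
have zG m (J : set R) : J `<=` `[t0, +oo[ -> ode_solution J (G m) (z m y).
  move=> sJ t Jt; rewrite /G /g -[K m y *: _]opprK.
  apply: is_derivative_onB; last exact: is_derivative_on_expRZ.
  by apply: (is_derivative_on_subset sJ); apply: (Fw m).2; exact: sJ.
have z0 m : z m y (ts m.-1) = 0.
  by rewrite /z /r subrr mulr0 expR0 scale1r subrr.
split.
- by split; rewrite /ts mul0r addr0.
- by move=> m m0; rewrite tsS// ltrDl.
- apply/cvgryPge => A.
  near=> m.
  have m0 : (0 < m)%N by near: m; exact: nbhs_infty_gt.
  rewrite /ts -lerBlDl -ler_pdivrMr//.
  have : (A - t0) / (tau / 2) + 1 <= m%:R by near: m; exact: nbhs_infty_ger.
  have -> : m%:R = m.-1%:R + 1 :> R by rewrite natr1 prednK.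
  by rewrite lerD2r.
- move=> m m0; apply/subspace_continuousP => -[[t u] v] /= tJ.
  have J0 : `[ts m.-1, ts m.+1] `<=` [set s | 0 <= s].
    by move=> s /(sub m m0) /=; rewrite in_itv/= andbT; exact: le_trans.
  have cw : w m y @ within `[ts m.-1, ts m.+1] (nbhs t) --> w m y t.
    apply: is_derivative_on_cvg (is_derivative_on_subset (sub m m0) ((Fw m).2 t _)).
    exact: sub tJ.
  have cr : r m y @ within `[ts m.-1, ts m.+1] (nbhs t) --> r m y t.
    exact: (is_derivative_on_cvg (@is_derivative_on_expRZ n 1 _
      (w m y (ts m.-1)) (K m y) (ts m.-1) t)).
  have cg : (fun t => F t (w m y t) + K m y *: r m y t) @
      within `[ts m.-1, ts m.+1] (nbhs t) --> F t (w m y t) + K m y *: r m y t.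
    apply: cvgD; last exact: cvgZr.
    exact: C0_halfspace_comp.
  move=> A /cg HA.
  have : continuous (fun p : R * 'cV[R]_n * 'cV[R]_k => p.1.1).
    by move=> p; apply: (@cvg_comp _ _ _ fst fst _ (nbhs p.1)); exact: cvg_fst.
  by move=> /(_ (t, u, v) _ HA).
split; first by exists 0.
- move=> m m0 J zs iJ Ja sJ zs0 Hzs; exists (z m y).
    by apply: zG; exact: sub.
  move=> t Jt; apply: (is_derivative_on_unique iJ Ja _ _ _ Hzs Jt).
  - by move=> s /sJ /=; rewrite in_itv/= => /andP[].
  - by rewrite z0 zs0.
  - by apply: zG; apply: subset_trans (sub m m0).
move=> x0 x Mx0 Fx yx zs Z Hzs HZ.
have [rho rho0 Hrho] := err t0 y x0 x t00 yO Mx0 Fx yx.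
apply/cvgrPdist_le => e e0.
have e2 : 0 < e / 2 by rewrite divr_gt0.
have rho_e : \forall t \near +oo, `|0 - rho t| <= e / 2.
  by move/cvgrPdist_le : rho0; exact.
near=> t; rewrite sub0r normrN.
(* The first threshold gives [m >= 2], the second [1 / m <= e / 2], for the stage [m] active at time
   [t]. *)
have tt1 : t0 + tau / 2 <= t by near: t; apply: nbhs_pinfty_ge; exact: num_real.
have tt2 : t0 + (tau / 2) * (e / 2)^-1 <= t.
  by near: t; apply: nbhs_pinfty_ge; exact: num_real.
have rho_t : `|0 - rho t| <= e / 2 by near: t.
pose b := (t - t0) / (tau / 2).
have b1 : 1 <= b by rewrite ler_pdivlMr// mul1r lerBrDl.
have b2 : (e / 2)^-1 <= b by rewrite ler_pdivlMr// mulrC lerBrDl.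
have b0 : 0 <= b by exact: le_trans b1.
(* [b] counts the steps elapsed since [t0]; the successor compensates the predecessor in [ts]. *)
pose m := (Num.truncn b).+1.
have /andP[mb bm] := truncn_itv b0.
have tE : t = t0 + b * (tau / 2) by rewrite /b divfK ?gt_eqF// addrC subrK.
(* Only from the second stage on does [ts m] come a full step after [ts m.-1], as the damping of [r]
   requires. *)
have m1 : (1 < m)%N by rewrite ltnS truncn_gt0.
have tsm : ts m <= t by rewrite tE lerD2l ler_wpM2r// ltW.
have tm : t < ts m.+1 by rewrite tE ltrD2l ltr_pM2r.
have m0 : (0 < m)%N by [].
have tsmE : ts m = ts m.-1 + tau / 2 by rewrite -tsS//= ltnW.
rewrite (HZ m)//; last by rewrite in_itv/= tsm tm.
have [zs0 Hz] := Hzs m m0.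
have tsi : `[ts m.-1, ts m.+1]%classic t.
  by rewrite /= in_itv/= (ltW tm) andbT (le_trans _ tsm)// tsmE lerDl ltW.
have -> : zs m t = z m y t.
  apply: (is_derivative_on_unique (a := ts m.-1)
    (@interval_is_interval _ `[ts m.-1, ts m.+1])
    _ _ _ Hz (zG m _ (sub m m0)) tsi).
  - by rewrite /= in_itv/= lexx (ts_le m).
  - by move=> s /=; rewrite in_itv/= => /andP[].
  - by rewrite z0 zs0.
(* The error is [(x - w) + r]. As [(x0, x)] belongs to [S m y], near minimality bounds the initial
   norm of [w] as [rho] requires. *)
rewrite /z opprB addrCA addrC (le_trans (ler_normD _ _))// [leRHS]splitr lerD//.
  apply: le_trans rho_t; rewrite sub0r normrN; apply: le_trans (ler_norm _).
  have [[Mw _ Hw] wmin] := Hc _ (Sy m).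
  apply: (Hrho (T m) (c (S m y)).1) => //.
  - exact: le_lt_trans (le_trans (ts_ge m) tsm) (lt_le_trans tm (tsT m m0)).
  - apply: wmin (x0, x) _; split=> // s /andP[ss _]; exact/esym/yx.
  by rewrite (le_trans (ts_ge m) tsm) (le_trans (ltW tm)) ?tsT.
rewrite /r normrZ ger0_norm ?expR_ge0//.
set N := `|w m y (ts m.-1)|.
have N0 : 0 <= N by exact: normr_ge0.
apply: (@le_trans _ _ (expR (- (m%:R * N)) * N)).
  rewrite ler_wpM2r// ler_expR mulNr lerN2 /K -/N.
  have -> : m%:R * N = (tau / 2)^-1 * m%:R * N * (tau / 2).
    by field; rewrite (gt_eqF tau0).
  rewrite ler_wpM2l ?mulr_ge0 ?invr_ge0 ?(ltW tau2)//.
  by rewrite lerBrDl -tsmE.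
apply: le_trans (expRN_mul_le _ N0) _; first by rewrite ltr0n.
by rewrite invf_ple ?posrE// (le_trans b2)// ltW.
Unshelve. all: by end_near. Qed.

End SwitchingObserver.

(** * Norm inequalities for blocks and differences *)

Section EnormBlocks.
Context {R : realType}.

Lemma enorm_dsubmx_le {n1 n2} (x : 'cV[R]_(n1 + n2)) : enorm (dsubmx x) <= enorm x.
Proof.
apply: ler_wsqrtr; rewrite [leRHS]big_split_ord/= -[leLHS]add0r.
apply: lerD; first by apply: sumr_ge0 => i _; exact: sqr_ge0.
by apply: ler_sum => i _; rewrite mxE.
Qed.

Lemma enormB_sq_le {n} (u v : 'cV[R]_n) :
  enorm (u - v) ^+ 2 <= 2 * enorm u ^+ 2 + 2 * enorm v ^+ 2.
Proof.
rewrite !enormE !mulr_sumr -big_split/=; apply: ler_sum => i _.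
rewrite !mxE -subr_ge0.
rewrite (_ : _ - _ = (u i ord0 + v i ord0) ^+ 2); last by ring.
exact: sqr_ge0.
Qed.

End EnormBlocks.

(** * The error rate of the triangular system and solvability of the observer problem *)

Theorem corollary3p1 (R : realType) (n1 n2 : nat)
    (hn1 : (0 < n1)%N) (hn2 : (0 < n2)%N)
    (f1 : R -> 'cV[R]_n1 -> 'cV[R]_n1)
    (f2 : R -> 'cV[R]_n1 -> 'cV[R]_n2 -> 'cV[R]_n2)
    (a : R -> 'cV[R]_n1 -> R)
    (B : R -> 'cV[R]_n1 -> 'M[R]_(n1, n2))
    (f1_cont : C0_halfspace f1)
    (f1_lip : locally_lipschitz_x f1)
    (f2_cont : C0_halfspace
       (fun t (x : 'cV[R]_(n1 + n2)) => f2 t (usubmx x) (dsubmx x)))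
    (f2_lip : locally_lipschitz_x
       (fun t (x : 'cV[R]_(n1 + n2)) => f2 t (usubmx x) (dsubmx x)))
    (a_C1 : C1_halfspace a)
    (B_C1 : C1_halfspace B)
    (F := triangular_field f1 f2 a B)
    (h := @triangular_output R n1 n2)
    (M : set 'cV[R]_(n1 + n2))
    (M_neq0 : M !=set0)
    (M_cl : closure M 0)
    (beta : R -> R -> R -> R)
    (M_complete : forward_complete F M beta)
    (* (1) *)
    (l : nat) (hl : (0 < l)%N)
    (D : R -> 'cV[R]_l -> 'cV[R]_n1 -> 'M[R]_n2)
    (D_cont : {within [set p : R * 'cV[R]_l * 'cV[R]_n1 | 0 <= p.1.1],
       continuous (fun p => D p.1.1 p.1.2 p.2)})
    (Q : forall r t0 xi : R, R -> set 'cV[R]_l)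
    (Q_CP : forall r t0 xi : R, 0 < r -> 0 <= t0 -> 0 < xi ->
       compactness_property t0 (Q r t0 xi))
    (f2_D : forall r t0 xi : R, 0 < r -> 0 <= t0 -> 0 < xi ->
       forall t, t0 <= t ->
       forall y, (exists x : 'cV[R]_(n1 + n2),
                    enorm x <= beta t t0 r /\ y = usubmx x) ->
       forall x2 z2, enorm x2 <= beta t t0 r -> enorm (x2 - z2) <= xi ->
       exists2 q, Q r t0 xi t q &
         f2 t y x2 - f2 t y z2 = D t q y *m (x2 - z2))
    (* (2) *)
    (hP : exists L : R, 1 < L /\
       forall r : R, 0 < r -> exists eps : R, 0 < eps /\
       forall t0 tb0 tau0 xi : R,
         0 <= t0 -> t0 <= tb0 -> 0 < tau0 -> 0 < xi ->
       let Omega := outputs F h [set t | 0 <= t] M in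
       exists (P dP : (R -> 'cV[R]_n1) -> R -> 'M[R]_n2)
              (d : (R -> 'cV[R]_n1) -> R -> R),
         [/\ noncausal tau0 Omega t0 (fun=> `[tb0, +oo[%classic) P,
             noncausal tau0 Omega t0 (fun=> `[tb0, +oo[%classic) d
         & forall y, C0_outputs Omega t0 y ->
           let intd t := \int[lebesgue_measure]_(s in `[tb0, t]) d y s in
           [/\ C1_on `[tb0, +oo[ (P y) (dP y)
                 /\ {within `[tb0, +oo[, continuous (d y)},
               forall t, tb0 <= t ->
                 (P y t)^T = P y t /\ loewner_le 1%:M (P y t),
               opnorm (P y tb0) <= L,
               (forall t, tb0 <= t -> - eps < intd t) /\ intd @ +oo --> +oo
             & C0_outputs (outputs F h [set t | 0 <= t] (eball r `&` M)) t0 y ->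
               forall t e q, tb0 <= t -> B t (y t) *m e = 0 -> Q r t0 xi t q ->
                 qform (P y t *m D t q (y t)) e + 2^-1 * qform (dP y t) e
                   <= - d y t * qform (P y t) e]])
    (* (3) *)
    (ha : forall t0 x0 x, 0 <= t0 -> M x0 -> trajectory F t0 x0 x ->
       {ae lebesgue_measure, forall t, t0 <= t -> a t (usubmx (x t)) != 0}) :
  AC_SODP_solvable F h M.
Proof.
have [F_lip F_C0] := triangular_field_regular f1_cont f1_lip f2_cont f2_lip a_C1 B_C1.
have [beta_NNN beta_ex] := M_complete.
have [L [L1 HL]] := hP.
have L0 : 0 < L by exact: lt_trans L1.
apply: (AC_SODP_of_uniform_error F_C0) => t0 y x0 x t00 yO Mx0 xtraj yx.
(* [forward_complete] bounds some trajectory from [x0]; by uniqueness it is [x]. *)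
have x_beta t : t0 <= t -> enorm (x t) <= beta t t0 (enorm x0).
  have [x' [x'traj x'b]] := beta_ex t0 x0 t00 Mx0.
  by move=> tt; rewrite (trajectory_unique F_lip t00 xtraj x'traj tt); exact: x'b.
pose r := enorm x0 + 1.
have r0 : 0 < r by rewrite ltr_wpDl ?enorm_ge0.
have x_beta_r t : t0 <= t -> enorm (x t) <= beta t t0 r.
  move=> tt; apply: le_trans (x_beta t tt) _.
  have [_ _ /(_ t t0 (enorm x0) t t0 r)] := beta_NNN.
  case; rewrite ?enorm_ge0 ?(le_trans t00)// => _ [_]; apply.
  by rewrite lerDl.
have [eps [eps0 Heps]] := HL r r0.
(* Bounds [L * enorm (e t0) ^+ 2], as both initial points have norm at most [r]. *)
pose c := L * (4 * r ^+ 2).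
have c0 : 0 < c by rewrite !mulr_gt0.
(* [eps] depends on [r] only, so [xi] can be chosen after it; the added [1] makes [xi] positive and
   the next inequality strict. *)
pose xi := Num.sqrt (c * expR (2 * eps)) + 1.
have xi0 : 0 < xi by rewrite ltr_wpDl ?sqrtr_ge0.
have c_xi : c * expR (2 * eps) < xi ^+ 2.
  have : 0 <= c * expR (2 * eps) by rewrite mulr_ge0 ?expR_ge0// ltW.
  move=> /sqr_sqrtr {1}<-.
  by rewrite ltrXn2r// ?nnegrE ?sqrtr_ge0 ?(ltW xi0)// ltrDl.
(* With [tb0 = t0], the bound [L] on [P] applies at the initial time, where the error is controlled
   by [r]. *)
have [P [dP [d [_ _ /(_ y yO)]]]] := Heps t0 t0 1 xi t00 (lexx _) ltr01 xi0.
move=> [[[HP _] cd] Psym PL [I_eps I_oo] dec].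
set I := (fun t => \int[lebesgue_measure]_(s in `[t0, t]) d y s) in I_eps I_oo.
have yO_r : C0_outputs (outputs F h [set t | 0 <= t] (eball r `&` M)) t0 y.
  case: yO => _ cy; split=> //; split=> //; exists x0, x; split=> //.
  by split=> //; rewrite /eball /= /r lerDl.
exists (fun t => Num.sqrt (c * expR (- 2 * I t))).
  apply/cvgrPdist_le => e e0; near=> t.
  (* Sufficient because [c / e ^+ 2 <= 1 + 2 * I t <= expR (2 * I t)]. *)
  have It : c / e ^+ 2 <= I t by near: t; move/cvgryPge: I_oo; exact.
  rewrite sub0r normrN ger0_norm ?sqrtr_ge0// -[leRHS]ger0_norm ?(ltW e0)//.
  rewrite -sqrtr_sqr ler_wsqrtr// mulNr expRN ler_pdivrMr ?expR_gt0//.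
  rewrite mulrC -ler_pdivrMr ?exprn_gt0//.
  apply: le_trans (expR_ge1Dx _).
  have : 0 <= c / e ^+ 2 by rewrite divr_ge0 ?sqr_ge0// ltW.
  lra.
move=> T w0 w t0T Mw0 w0r wtraj wy t tT.
have sub : `[t0, T] `<=` `[t0, +oo[.
  by move=> s /=; rewrite !in_itv/= => /andP[->].
have xw s : t0 <= s <= T -> usubmx (x s) = usubmx (w s).
  by move=> /[dup] sT /andP[ss _]; rewrite -[LHS]/(h s (x s)) -yx// -wy.
have a0 := ha t0 x0 x t00 Mx0 xtraj.
have ker := same_output_kernel B_C1 t00 t0T xtraj.2 wtraj.2 a0 xw.
pose e s := dsubmx (x s) - dsubmx (w s).
pose de s := f2 s (usubmx (x s)) (dsubmx (x s)) - f2 s (usubmx (w s)) (dsubmx (w s)).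
have He s : t0 <= s <= T -> is_derivative_on `[t0, T] e s (de s).
  have blk (v : R -> 'cV[R]_(n1 + n2)) : ode_solution `[t0, +oo[ F v ->
      t0 <= s <= T -> is_derivative_on `[t0, T] (fun s => dsubmx (v s)) s
        (f2 s (usubmx (v s)) (dsubmx (v s))).
    move=> Hv sT; apply: is_derivative_on_mx => i j; rewrite (ord1 j) {j}.
    have -> : (fun s => dsubmx (v s) i ord0) = (fun s => v s (rshift n1 i) ord0).
      by apply/funext => u; rewrite mxE.
    have := is_derivative_on_entry (i := rshift n1 i) (j := ord0)
      (is_derivative_on_subset sub (Hv s (sub s sT))).
    by rewrite [X in is_derivative_on _ _ _ X]col_mxEd.
  by move=> sT; apply: is_derivative_onB; [exact: blk xtraj.2 sT|exact: blk wtraj.2 sT].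
have e0_le : enorm (e t0) ^+ 2 <= 4 * r ^+ 2.
  rewrite (le_trans (enormB_sq_le _ _))//.
  have sq_le (v : 'cV[R]_(n1 + n2)) : enorm v <= r -> enorm (dsubmx v) ^+ 2 <= r ^+ 2.
    move=> vr; rewrite ler_sqr ?nnegrE ?enorm_ge0 ?(ltW r0)//.
    exact: le_trans (enorm_dsubmx_le _) vr.
  have := sq_le (x t0); rewrite xtraj.1 lerDl => /(_ ler01).
  have := sq_le (w t0); rewrite wtraj.1 => /(_ w0r).
  lra.
have L_le : L * enorm (e t0) ^+ 2 <= c by rewrite ler_wpM2l// ltW.
have decay : enorm (e t) ^+ 2 <= L * enorm (e t0) ^+ 2 * expR (- 2 * I t).
  apply: (@weighted_decay R n2 t0 T L eps xi (P y) (dP y) e de (d y)) => //.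
  - exact: ltW.
  - exact: ltW.
  - by move=> s sT; apply: (is_derivative_on_subset sub); apply: HP; exact: sub.
  - exact: continuous_subspaceW sub cd.
  - by move=> s /andP[ss _]; exact: Psym.
  - by move=> s /andP[ss _]; exact: I_eps.
  - by apply: le_lt_trans c_xi; rewrite ler_wpM2r ?expR_ge0.
  move=> s /andP[s0 sT] exi.
  have sT' : t0 <= s <= T by rewrite !ltW.
  have ys : y s = usubmx (x s) by rewrite yx// ltW.
  have ys_ex : exists v : 'cV[R]_(n1 + n2), enorm v <= beta s t0 r /\ y s = usubmx v.
    by exists (x s); split; [exact: x_beta_r (ltW s0)|exact: ys].
  (* The bound [beta] is used for [x]; [w] is controlled through its distance at most [xi] from
     [x]. *)
  have [q Qq Dq] := f2_D r t0 xi r0 t00 xi0 s (ltW s0) (y s) ys_ex _ _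
    (le_trans (enorm_dsubmx_le _) (x_beta_r s (ltW s0))) exi.
  have := dec yO_r s (e s) q (ltW s0) _ Qq.
  rewrite ys (ker s sT') => /(_ erefl).
  by rewrite /de -(xw s sT') -ys Dq /qform !mulmxA.
have e_le : enorm (e t) <= Num.sqrt (c * expR (- 2 * I t)).
  rewrite -[leLHS]ger0_norm ?enorm_ge0// -sqrtr_sqr ler_wsqrtr//.
  by apply: le_trans decay _; rewrite ler_wpM2r ?expR_ge0.
apply: mx_norm_le => [|i j]; first exact: sqrtr_ge0.
(* The upper block of [x - w] vanishes because the outputs agree; the lower one is [e]. *)
rewrite (ord1 j) {j} -(splitK i); case: (fintype.split i) => k /=.
  have /matrixP/(_ k ord0) := xw t tT; rewrite !mxE => ->.
  by rewrite subrr normr0 sqrtr_ge0.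
apply: le_trans e_le; apply: le_trans (norm_le_enorm _).
by have := ler_entry (e t) k ord0; rewrite !mxE.
Unshelve. all: by end_near. Qed.
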